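(* Let $0\le d_1\le d_2\le d_3$ be integers and let $$J'=J'(d_1,d_2,d_3)=\bigcap_{1\le i<j\le 3}(t_i-t_j,\;x_i-x_j)^{\min(d_i,d_j)}\subseteq\mathbb{C}[t_1,t_2,t_3,x_1,x_2,x_3].$$ Then: (a) the bigraded Hilbert series of the ideal $J'$ equals $H(d_1,d_2,d_3)$; (b) the bigraded Hilbert series of the generating set $J'/\mathfrak{m}J'$, where $\mathfrak{m}=(t_1,t_2,t_3,x_1,x_2,x_3)$, equals $F(d_1,d_2,d_3)$. Here, with $n=3$, $$H(d_1,\ldots,d_n)=\sum_{T}\frac{z_1^{d_n}\cdots z_n^{d_1}}{(1-q)^n(1-t)^n}\prod_{i=2}^{n}\frac{1}{1-z_i^{-1}}\prod_{i<j}\omega(z_i/z_j),$$ $$F(d_1,\ldots,d_n)=\sum_{T}z_1^{d_n}\cdots z_n^{d_1}\prod_{i=2}^{n}\frac{1}{(1-z_i^{-1})(1-qtz_{i-1}/z_i)}\prod_{i<j}\omega(z_i/z_j).$$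
   Context: The polynomial ring is bigraded: each $t_i$ has bidegree $q$ and each $x_i$ has bidegree $t$; the Hilbert series of a bigraded vector space $V=\bigoplus V_{a,b}$ is $\sum\dim(V_{a,b})q^at^b$. In the formulas for $H$ and $F$: the sums are over standard Young tableaux $T$ with $n$ boxes (of any shape); $z_i=q^{c-1}t^{r-1}$ is the $(q,t)$-content of the box labeled $i$, located in row $r$ and column $c$ of $T$; $\omega(x)=\frac{(1-x)(1-qtx)}{(1-qx)(1-tx)}$; and by convention all factors of the form $(1-1)$ occurring in the products, in the numerator or in the denominator, are ignored (omitted). The function $F$ is known as the generalized $(q,t)$-Catalan number. The equality with a rational function means that the Hilbert series is the power series expansion of that function. *)

(* Defs.v *)
From HB Require Import structures.
From mathcomp Require Import all_boot all_order all_algebra.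
From mathcomp Require Import mpoly complex.
From mathcomp Require Import classical_sets reals.

Set Implicit Arguments.
Unset Strict Implicit.
Unset Printing Implicit Defensive.

Import Order.TTheory GRing.Theory Num.Theory.
Local Open Scope ring_scope.
Local Open Scope classical_set_scope.

Section Ideals.
Variable A : comNzRingType.
Implicit Types (S I J : set A) (k : nat).

Definition ideal_mul I J : set A :=
  [set p | exists r : seq (A * A),
     (forall x, x \in r -> I x.1 /\ J x.2) /\ p = \sum_(x <- r) x.1 * x.2].

Definition ideal_gen S : set A := ideal_mul setT S.

Fixpoint ideal_pow I k : set A :=
  if k is k'.+1 then ideal_mul I (ideal_pow I k') else setT.

End Ideals.

(* [has_dim_mod V W d]: the image of V in the quotient by W, i.e.
   V / (V `&` W) for subspaces V and W, has dimension d over K. *)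
Definition has_dim_mod (K : fieldType) (E : lmodType K) (V W : set E)
    (d : nat) : Prop :=
  exists e : 'I_d -> E,
    [/\ forall i, V (e i),
        forall c : 'I_d -> K, W (\sum_i c i *: e i) -> forall i, c i = 0
      & forall v, V v -> exists c : 'I_d -> K, W (v - \sum_i c i *: e i)].

Section Bigraded.
Variables (K : fieldType) (n : nat).
Local Notation P := {mpoly K[n + n]}.

Definition tvar (i : 'I_n) : P := 'X_(lshift n i).
Definition xvar (i : 'I_n) : P := 'X_(rshift n i).

Definition bidegree (m : 'X_{1..n + n}) : nat * nat :=
  ((\sum_(i < n) m (lshift n i))%N, (\sum_(i < n) m (rshift n i))%N).

Definition bihomog (a b : nat) : set P :=
  [set p | forall m, m \in msupp p -> bidegree m = (a, b)].

(* h a b is the coefficient of q^a t^b. *)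
Definition hilbert_series_mod (V W : set P) (h : nat -> nat -> nat) : Prop :=
  forall a b, has_dim_mod (V `&` bihomog a b) W (h a b).

Definition hilbert_series (V : set P) (h : nat -> nat -> nat) : Prop :=
  hilbert_series_mod V [set 0] h.

Definition diag_ideal (i j : 'I_n) : set P :=
  ideal_gen [set tvar i - tvar j; xvar i - xvar j].

Definition Jprime (d : n.-tuple nat) : set P :=
  [set p | forall i j : 'I_n, (i < j)%N ->
     ideal_pow (diag_ideal i j) (minn (tnth d i) (tnth d j)) p].

Definition irrelevant_ideal : set P :=
  ideal_gen (range tvar `|` range xvar).

End Bigraded.

(* Rational functions in q and t: q is the outer variable of
   {poly {poly rat}}, so p`_a`_b is the coefficient of q^a t^b. *)
Local Notation ratfun := {fraction {poly {poly rat}}}.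

Definition qv : ratfun := tofrac 'X.
Definition tv : ratfun := tofrac ('X%:P).

Definition is_expansion (f : ratfun) (h : nat -> nat -> nat) : Prop :=
  exists N D : {poly {poly rat}},
    [/\ D`_0`_0 != 0, f = tofrac N / tofrac D
      & forall a b, \sum_(i < a.+1) \sum_(j < b.+1)
                      D`_i`_j * (h (a - i) (b - j))%N%:R = N`_a`_b].

(* A tableau with n boxes is given by the (row, column) of the box carrying
   each label; labels, rows and columns are numbered from 0. *)
Definition standard n (T : {ffun 'I_n -> 'I_n * 'I_n}) : bool :=
  [&& injectiveb T,
      [forall i : 'I_n, forall p : 'I_n * 'I_n,
         (p.1 <= (T i).1)%N && (p.2 <= (T i).2)%N ==> (p \in codom T)],
      [forall i : 'I_n, forall j : 'I_n,
         ((T i).1 == (T j).1) && ((T i).2 < (T j).2)%N ==> (i < j)%N]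
    & [forall i : 'I_n, forall j : 'I_n,
         ((T i).2 == (T j).2) && ((T i).1 < (T j).1)%N ==> (i < j)%N]].

Definition content n (T : {ffun 'I_n -> 'I_n * 'I_n}) (i : 'I_n) : ratfun :=
  qv ^+ (T i).2 * tv ^+ (T i).1.

(* The factor 1 - x, omitted when x = 1. *)
Definition factor (x : ratfun) : ratfun := if x == 1 then 1 else 1 - x.

Definition omega (x : ratfun) : ratfun :=
  (factor x * factor (qv * tv * x)) / (factor (qv * x) * factor (tv * x)).

(* [tnth d (rev_ord i)] is the exponent d_(n+1-i) of z_i. *)
Definition Hfun n (d : n.-tuple nat) : ratfun :=
  \sum_(T : {ffun 'I_n -> 'I_n * 'I_n} | standard T)
    let z := content T in
    (\prod_(i < n) z i ^+ tnth d (rev_ord i))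
      / ((1 - qv) ^+ n * (1 - tv) ^+ n)
    * (\prod_(i < n | (0 < i)%N) (factor ((z i)^-1))^-1)
    * \prod_(i < n) \prod_(j < n | (i < j)%N) omega (z i / z j).

Definition Ffun n (d : n.-tuple nat) : ratfun :=
  \sum_(T : {ffun 'I_n -> 'I_n * 'I_n} | standard T)
    let z := content T in
    (\prod_(i < n) z i ^+ tnth d (rev_ord i))
    * (\prod_(i < n | (0 < i)%N)
         (factor ((z i)^-1) * factor (qv * tv * z (ord_pred i) / z i))^-1)
    * \prod_(i < n) \prod_(j < n | (i < j)%N) omega (z i / z j).

(* Main.v *)
Require Import Defs.
From HB Require Import structures.
From mathcomp Require Import all_boot all_order all_algebra.
From mathcomp Require Import ring zify.
From mathcomp Require Import mpoly complex.
From mathcomp Require Import classical_sets reals.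

(** Write [a = d1], [b = d2], [u = t2 - t3], [v = t1 - 2 t2 + t3] and let [u'],
[v'] be the same combinations of the [x_i].  Let [Iij] be the ideal of the
diagonal i = j.  The ideal of the theorem is the intersection [J(a, b)] of
[I12^a], [I13^a] and [I23^b].

The proof filters [J(a, b)] by the powers of the minor [disc = u v' - u' v],
which vanishes exactly when the three points [(t_i, x_i)] are collinear.
Along each diagonal it vanishes to order exactly one.  Membership in a power
of [Iij] is an order of vanishing: substituting [t_j + s (t_i - t_j)] for
[t_i], and similarly for [x_i], must produce a multiple of [s^k]
([ideal_pow_diagP]).  Since this substitution multiplies [disc] by [s], the
product [disc * p] lies in [J(a, b)] if and only if [p] lies in [J(a-1, b-1)],
with truncated subtraction ([diag_inter_disc]).

It remains to describe [J(a, b)] modulo [disc].  On collinear triples the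
bihomogeneous polynomials become polynomials in the position [t3], [x3] of the
third point and in one parameter along the line; the parameter differences
of the pairs 23, 12 and 13 are the coprime linear polynomials [X], [X + 1] and
[2 X + 1].  An element of [J(a, b)] therefore restricts to a multiple of
[X^b (X+1)^a (2X+1)^a], of degree [e = 2a + b], and every multiple whose degree
is compatible with the bidegree is the restriction of a combination of
products of linear forms lying in [J(a, b)] ([gen]).  Conversely a bihomogeneous polynomial that
restricts to zero is divisible by [disc], because permuting the factors of a
product of linear forms between the [t] and the [x] variables changes it by a
multiple of [disc] ([mixed_prod_perm]).  This yields the decomposition
[diag_inter_decomp] of [J(a, b)] as the direct sum of the span of the
[gen]s and of [disc * J(a-1, b-1)].

For (a), counting the [gen]s in each bidegree gives a recursion for the
dimensions, [dim_ideal].  For (b), the [gen]s of total degree greater than [e]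
lie in [m J], and so does [disc * q] when its degree is at least [e]; in
degrees at most [e], both [J] and [m J] come from [disc * J(a-1, b-1)], apart
from the [gen]s of degree exactly [e].  Hence the minimal generators are
[disc^k] times the [gen]s of [J(a-k, b-k)] of degree [2(a-k) + (b-k)], for
[k <= a], and the
generating series is the sum over [k <= a] of [(q t)^k h_(2a+b-3k)(q, t)], with
[h] the complete homogeneous symmetric polynomial.

Finally, there are four standard tableaux with three boxes, and the resulting
explicit rational functions satisfy the same recursions in [(a, b)] as the
dimension counts: under [(a, b) -> (a+1, b+1)] the two hook-shaped tableaux
are multiplied by [q t], so that only the row and the column contribute to
the difference ([hilb4_SS], [catalan4_SS]). *)

Set Implicit Arguments.
Unset Strict Implicit.
Unset Printing Implicit Defensive.

Import Order.TTheory GRing.Theory Num.Theory.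
Local Open Scope ring_scope.

(** * Ideals of commutative rings and substitutions *)

Section IdealProducts.
Variable A : comNzRingType.
Implicit Types (I J S : set A) (p q : A) (k l : nat).
Local Open Scope classical_set_scope.

Lemma ideal_mul_ind I J (Q : A -> Prop) : Q 0 ->
    (forall p q, Q p -> Q q -> Q (p + q)) ->
    (forall p q, I p -> J q -> Q (p * q)) ->
  forall p, ideal_mul I J p -> Q p.
Proof.
move=> Q0 QD QM p [r [rIJ ->]]; elim: r rIJ => [|x r IHr] rIJ.
  by rewrite big_nil.
rewrite big_cons; apply: QD; last first.
  by apply: IHr => y yr; apply: rIJ; rewrite inE yr orbT.
by have [] := rIJ x (mem_head _ _); apply: QM.
Qed.

Lemma ideal_mul_mem I J p q : I p -> J q -> ideal_mul I J (p * q).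
Proof.
move=> Ip Jq; exists [:: (p, q)]; rewrite big_seq1; split=> // x.
by rewrite inE => /eqP->.
Qed.

Lemma ideal_mul0 I J : ideal_mul I J 0.
Proof. by exists [::]; rewrite big_nil. Qed.

Lemma ideal_mulD I J p q :
  ideal_mul I J p -> ideal_mul I J q -> ideal_mul I J (p + q).
Proof.
move=> [r [rIJ ->]] [s [sIJ ->]]; exists (r ++ s); rewrite big_cat.
by split=> // x; rewrite mem_cat => /orP[/rIJ | /sIJ].
Qed.

Lemma ideal_mulMl I J p q : (forall r, J r -> J (p * r)) ->
  ideal_mul I J q -> ideal_mul I J (p * q).
Proof.
move=> JM; elim/ideal_mul_ind: q / => [|q r Iq Ir|q r Iq Jr].
- by rewrite mulr0; apply: ideal_mul0.
- by rewrite mulrDr; apply: ideal_mulD.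
by rewrite mulrCA; apply: ideal_mul_mem => //; apply: JM.
Qed.

Lemma ideal_gen0 S : ideal_gen S 0.
Proof. exact: ideal_mul0. Qed.

Lemma ideal_genD S p q : ideal_gen S p -> ideal_gen S q -> ideal_gen S (p + q).
Proof. exact: ideal_mulD. Qed.

Lemma ideal_gen_mem S p : S p -> ideal_gen S p.
Proof. by rewrite -[p in ideal_gen _ p]mul1r; apply: ideal_mul_mem. Qed.

Lemma ideal_genMl S p q : ideal_gen S q -> ideal_gen S (p * q).
Proof.
elim/ideal_mul_ind: q / => [|q r Iq Ir|q r _ Sr].
- by rewrite mulr0; apply: ideal_gen0.
- by rewrite mulrDr; apply: ideal_genD.
by rewrite mulrA; apply: ideal_mul_mem.
Qed.

Lemma ideal_pow0 I k : ideal_pow I k 0.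
Proof. by case: k => // k; apply: ideal_mul0. Qed.

Lemma ideal_powD I k p q :
  ideal_pow I k p -> ideal_pow I k q -> ideal_pow I k (p + q).
Proof. by case: k => // k; apply: ideal_mulD. Qed.

(** For every [I] whatsoever, because the empty product is all of [A]. *)
Lemma ideal_powMl I k p q : ideal_pow I k q -> ideal_pow I k (p * q).
Proof.
by elim: k q => // k IHk q Iq; apply: ideal_mulMl Iq => r; apply: IHk.
Qed.

Lemma ideal_powM I k l p q :
  ideal_pow I k p -> ideal_pow I l q -> ideal_pow I (k + l) (p * q).
Proof.
move=> + Iq; elim: k p => [|k IHk] p; first by move=> _; apply: ideal_powMl.
elim/ideal_mul_ind: p / => [|p r Ip Ir|p r Ip Ir].
- by rewrite mul0r; apply: ideal_pow0.
- by rewrite mulrDl; apply: ideal_powD.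
by rewrite -mulrA addSn; apply: ideal_mul_mem => //; apply: IHk.
Qed.

Lemma ideal_pow_mem I p : I p -> ideal_pow I 1 p.
Proof.
by move=> Ip; rewrite -[p]mulr1; apply: (@ideal_mul_mem I setT).
Qed.

Lemma ideal_pow_le I k l p : (k <= l)%N -> ideal_pow I l p -> ideal_pow I k p.
Proof.
move=> /subnK <-; elim: (l - k)%N p => // m IHm p.
rewrite addSn => Ip; apply: IHm; move: (m + k)%N Ip => {k l m} m.
elim: m p => // m IHm p; elim/ideal_mul_ind: p / => [|p q Ip Iq|p q Ip Iq].
- exact: ideal_pow0.
- exact: ideal_powD.
by apply: ideal_mul_mem => //; apply: IHm.
Qed.

End IdealProducts.

Section Substitutions.
Variables (K : fieldType) (n : nat).
Local Notation P := {mpoly K[n + n]}.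

Lemma mpoly_generators_ind (Q : P -> Prop) : (forall c, Q c%:MP) ->
    (forall i, Q (tvar K i)) -> (forall i, Q (xvar K i)) ->
    (forall p q, Q p -> Q q -> Q (p + q)) ->
    (forall p q, Q p -> Q q -> Q (p * q)) -> forall p, Q p.
Proof.
move=> QC Qt Qx QD QM p; rewrite [p]mpolyE.
apply: (big_ind Q) => [|//|m _]; first exact: (QC 0).
rewrite -mul_mpolyC; apply: (QM) => //; rewrite mpolyXE_id.
apply: (big_ind Q) => [|//|v _]; first exact: (QC 1).
elim: (m v) => [|k IHk]; first exact: (QC 1).
rewrite exprS; apply: (QM) => //.
case: (splitP v) => i vi.
  by rewrite (_ : v = lshift n i); [apply: Qt | apply: val_inj].
by rewrite (_ : v = rshift n i); [apply: Qx | apply: val_inj].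
Qed.

End Substitutions.

(** Locked, since unification may otherwise try to compare two substitutions by
    unfolding them to sums over supports of polynomials. *)
HB.lock Definition subst (K : fieldType) (n : nat) (S : comNzRingType)
    (c : {rmorphism K -> S}) (ht hx : 'I_n -> S) (p : {mpoly K[n + n]}) : S :=
  mmap c (fun v => match split v with inl i => ht i | inr i => hx i end) p.

Section SubstitutionTheory.
Variables (K : fieldType) (n : nat).
Variables (S : comNzRingType) (c : {rmorphism K -> S}) (ht hx : 'I_n -> S).

Let subst_zmod_morphism : zmod_morphism (subst c ht hx).
Proof. by move=> p q; rewrite unlock rmorphB. Qed.

Let subst_monoid_morphism : monoid_morphism (subst c ht hx).
Proof. by split=> [|p q]; rewrite unlock ?rmorph1 ?rmorphM. Qed.

HB.instance Definition _ := GRing.isZmodMorphism.Build {mpoly K[n + n]} S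
  (subst c ht hx) subst_zmod_morphism.
HB.instance Definition _ := GRing.isMonoidMorphism.Build {mpoly K[n + n]} S
  (subst c ht hx) subst_monoid_morphism.

Lemma subst_tvar i : subst c ht hx (tvar K i) = ht i.
Proof.
by rewrite unlock mmapX mmap1U -[lshift n i]/(unsplit (inl i)) unsplitK.
Qed.

Lemma subst_xvar i : subst c ht hx (xvar K i) = hx i.
Proof.
by rewrite unlock mmapX mmap1U -[rshift n i]/(unsplit (inr i)) unsplitK.
Qed.

Lemma subst_const a : subst c ht hx a%:MP = c a.
Proof. by rewrite unlock mmapC. Qed.

Lemma substZ a p : subst c ht hx (a *: p) = c a * subst c ht hx p.
Proof. by rewrite unlock mmapZ. Qed.

End SubstitutionTheory.

(** * Powers of diagonal ideals as orders of vanishing *)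

Section DiagonalPowers.
Variables (K : fieldType) (n : nat) (i j : 'I_n).
Local Notation P := {mpoly K[n + n]}.
Local Open Scope classical_set_scope.
Hypothesis neq_ij : i != j.

(** The point [i] moves along the line through the points [i] and [j]: it is at
    [j] for parameter 0 and at its original position for parameter 1. *)
Definition contract : P -> {poly P} :=
  subst (polyC \o @mpolyC (n + n) K)
    (fun k => if k == i then (tvar K j)%:P + 'X * (tvar K i - tvar K j)%:P
              else (tvar K k)%:P)
    (fun k => if k == i then (xvar K j)%:P + 'X * (xvar K i - xvar K j)%:P
              else (xvar K k)%:P).

HB.instance Definition _ := GRing.RMorphism.on contract.

Lemma contractD : {morph contract : p q / p + q}.
Proof. exact: rmorphD. Qed.

Lemma contractB : {morph contract : p q / p - q}.
Proof. exact: rmorphB. Qed.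

Lemma contractM : {morph contract : p q / p * q}.
Proof. exact: rmorphM. Qed.

Lemma contract0 : contract 0 = 0.
Proof. exact: rmorph0. Qed.

Lemma contract_const c : contract c%:MP = (c%:MP)%:P.
Proof. exact: subst_const. Qed.

Lemma contract_tvar k : contract (tvar K k) =
  if k == i then (tvar K j)%:P + 'X * (tvar K i - tvar K j)%:P
  else (tvar K k)%:P.
Proof. exact: subst_tvar. Qed.

Lemma contract_xvar k : contract (xvar K k) =
  if k == i then (xvar K j)%:P + 'X * (xvar K i - xvar K j)%:P
  else (xvar K k)%:P.
Proof. exact: subst_xvar. Qed.

Lemma contract_at1 p : (contract p).[1] = p.
Proof.
elim/mpoly_generators_ind: p => [c|k|k|p q IHp IHq|p q IHp IHq].
- by rewrite contract_const hornerC.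
- rewrite contract_tvar; case: eqP => [->|_]; rewrite ?hornerC //.
  by rewrite hornerD hornerM hornerX !hornerC mul1r addrC subrK.
- rewrite contract_xvar; case: eqP => [->|_]; rewrite ?hornerC //.
  by rewrite hornerD hornerM hornerX !hornerC mul1r addrC subrK.
- by rewrite contractD hornerD; congr (_ + _).
by rewrite contractM hornerM; congr (_ * _).
Qed.

(** The ideal powers form a filtration compatible with products, so it is enough
    to look at constants and variables. *)
Lemma coef_contract_mem p m :
  ideal_pow (@diag_ideal K n i j) m (contract p)`_m.
Proof.
have coefC_mem (c : P) l : ideal_pow (@diag_ideal K n i j) l (c%:P)`_l.
  by rewrite coefC; case: l => [|l] //; apply: (@ideal_pow0 _ _ l.+1).
have coef_line (c d : P) l : (@diag_ideal K n i j) d ->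
    ideal_pow (@diag_ideal K n i j) l (c%:P + 'X * d%:P)`_l.
  move=> Id; rewrite coefD; apply: ideal_powD => //; rewrite coefXM.
  case: l => [|[|l]] //; rewrite coefC; first exact: ideal_pow_mem.
  exact: (@ideal_pow0 _ _ l.+2).
elim/mpoly_generators_ind: p m => [c|k|k|p q IHp IHq|p q IHp IHq] m.
- by rewrite contract_const.
- rewrite contract_tvar; case: eqP => // _.
  by apply: coef_line; apply: ideal_gen_mem; left.
- rewrite contract_xvar; case: eqP => // _.
  by apply: coef_line; apply: ideal_gen_mem; right.
- by rewrite contractD coefD; apply: ideal_powD.
rewrite contractM coefM; apply: (big_ind (ideal_pow (@diag_ideal K n i j) m)).
- exact: ideal_pow0.
- by move=> x y; apply: ideal_powD.
move=> l _; rewrite -[X in ideal_pow _ X](subnKC (ltn_ord l : l <= m)%N).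
exact: ideal_powM.
Qed.

(** Evaluating at parameter 1 recovers [p] as the sum of the coefficients of
    [contract p]; this turns vanishing of the low coefficients into
    membership. *)
Lemma ideal_pow_diagP k p : ideal_pow (@diag_ideal K n i j) k p <->
  (forall m, (m < k)%N -> (contract p)`_m = 0).
Proof.
have diagX q : (@diag_ideal K n i j) q -> exists g, contract q = 'X * g.
  elim/ideal_mul_ind: q / => [|x y [g gE] [h hE]|x y _ Sy].
  - by exists 0; rewrite contract0 mulr0.
  - by exists (g + h); rewrite contractD gE hE mulrDr.
  suff [g gE] : exists g, contract y = 'X * g.
    by exists (contract x * g); rewrite contractM gE mulrCA.
  by case: Sy => ->; rewrite contractB ?contract_tvar ?contract_xvar eqxx
    eq_sym (negPf neq_ij) addrAC subrr add0r; eexists.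
split=> [Ip m ltmk | coefp0].
  suff [g ->] : exists g, contract p = 'X^k * g by rewrite coefXnM ltmk.
  elim: k p Ip {ltmk} => [|k IHk] p.
    by exists (contract p); rewrite mul1r.
  elim/ideal_mul_ind: p / => [|x y [g gE] [h hE]|x y Ix Iy].
  - by exists 0; rewrite contract0 mulr0.
  - by exists (g + h); rewrite contractD gE hE mulrDr.
  have [g gE] := diagX _ Ix; have [h hE] := IHk _ Iy.
  by exists (g * h); rewrite contractM gE hE exprS mulrACA.
rewrite -(contract_at1 p) horner_coef.
apply: (big_ind (ideal_pow (@diag_ideal K n i j) k)).
- exact: ideal_pow0.
- by move=> x y; apply: ideal_powD.
move=> m _; rewrite expr1n mulr1; have [lemk|ltmk] := leqP k m.
  exact: ideal_pow_le lemk (coef_contract_mem _ _).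
by rewrite coefp0 //; apply: ideal_pow0.
Qed.

(** A nonzero [D] that vanishes to order exactly one along the diagonal can be
    cancelled at the cost of one order, because polynomials over a domain form
    a domain. *)
Lemma ideal_pow_diag_cancel k D p : D != 0 -> contract D = 'X * D%:P ->
  ideal_pow (@diag_ideal K n i j) k (D * p) <->
  ideal_pow (@diag_ideal K n i j) k.-1 p.
Proof.
move=> D0 cD; rewrite !ideal_pow_diagP contractM cD -mulrA.
split=> coef0 m ltmk.
  have := coef0 m.+1; rewrite coefXM coefCM /= => /(_ _)/eqP.
  by rewrite mulf_eq0 (negPf D0) => /(_ _)/eqP; apply; case: k ltmk {coef0}.
rewrite coefXM coefCM; case: m ltmk => //= m ltmk.
by rewrite coef0 ?mulr0 //; case: k ltmk {coef0}.
Qed.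

End DiagonalPowers.

(** * Bihomogeneous components *)

Section Components.
Variables (K : fieldType) (n : nat).
Local Notation P := {mpoly K[n + n]}.
Local Open Scope classical_set_scope.
Implicit Types (p q : P) (A B C E : nat).

(** Scaling the two groups of variables by two independent parameters: the
    coefficients in the parameters are the bihomogeneous components. *)
Definition bigrade : P -> {poly {poly P}} :=
  subst (polyC \o (polyC \o @mpolyC (n + n) K))
    (fun i => 'X * (tvar K i)%:P%:P) (fun i => 'X%:P * (xvar K i)%:P%:P).

HB.instance Definition _ := GRing.RMorphism.on bigrade.

Definition component A B p : P := (bigrade p)`_A`_B.

Lemma bigradeZ c p : bigrade (c *: p) = (c%:MP)%:P%:P * bigrade p.
Proof. exact: substZ. Qed.

Lemma bigradeX m : bigrade 'X_[m] =
  'X^((bidegree m).1) * ('X^((bidegree m).2))%:P * ('X_[m])%:P%:P.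
Proof.
have bt : bigrade (\prod_(i < n) 'X_(lshift n i) ^+ m (lshift n i)) =
    'X^(\sum_(i < n) m (lshift n i)) *
    (\prod_(i < n) 'X_(lshift n i) ^+ m (lshift n i))%:P%:P.
  elim/big_rec2: _ => [|i k p _ IHp]; first by rewrite rmorph1 !mul1r.
  rewrite rmorphM rmorphXn /= IHp [bigrade _]subst_tvar exprMn.
  by rewrite mulrACA exprD !polyCM !polyC_exp.
have bx : bigrade (\prod_(i < n) 'X_(rshift n i) ^+ m (rshift n i)) =
    'X%:P ^+ (\sum_(i < n) m (rshift n i)) *
    (\prod_(i < n) 'X_(rshift n i) ^+ m (rshift n i))%:P%:P.
  elim/big_rec2: _ => [|i k p _ IHp]; first by rewrite rmorph1 !mul1r.
  rewrite rmorphM rmorphXn /= IHp [bigrade _]subst_xvar exprMn.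
  by rewrite mulrACA exprD !polyCM !polyC_exp.
rewrite mpolyXE_id big_split_ord rmorphM; move: bt bx => /=.
move: (\prod_(i < n) _) (\prod_(i < n) _) => p q -> ->.
by rewrite mulrACA polyC_exp !polyCM.
Qed.

Lemma componentD A B : {morph component A B : p q / p + q}.
Proof. by move=> p q; rewrite /component rmorphD !coefD. Qed.

Lemma componentZ A B c p : component A B (c *: p) = c *: component A B p.
Proof.
by rewrite /component bigradeZ /= !coefCM mul_mpolyC.
Qed.

Lemma componentX A B m : component A B 'X_[m] =
  if bidegree m == (A, B) then 'X_[m] else 0.
Proof.
rewrite /component bigradeX -mulrA -rmorphM coefXnM coefC.
case: (bidegree m) => A' B' /=; rewrite xpair_eqE.
case: (ltngtP A A') => [ltA|ltA|->] /=; first by rewrite coef0.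
  by rewrite subn_eq0 leqNgt ltA coef0.
rewrite subnn /= coefXnM coefC.
case: (ltngtP B B') => [//|ltB|->]; last by rewrite subnn.
by rewrite subn_eq0 leqNgt ltB.
Qed.

Lemma mcoeff_component A B p m :
  (component A B p)@_m = if bidegree m == (A, B) then p@_m else 0.
Proof.
elim/mpolyind: p => [|c m' p _ _ IHp].
  by rewrite /component rmorph0 !coef0 mcoeff0 if_same.
rewrite componentD componentZ componentX !mcoeffD IHp !mcoeffZ mcoeffX.
have [<-|neq_m] := eqVneq m' m.
  by case: ifP => _; rewrite ?mcoeffX ?eqxx ?mcoeff0 ?mulr0 ?addr0.
rewrite (_ : _@_m = 0); first by rewrite !mulr0 !add0r.
by case: ifP => _; rewrite ?mcoeffX ?(negPf neq_m) ?mcoeff0.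
Qed.

Lemma bihomog_component A B p : bihomog A B (component A B p).
Proof.
move=> m; rewrite mcoeff_msupp mcoeff_component.
by case: ifP => [/eqP //|_]; rewrite eqxx.
Qed.

Lemma component_bihomog A B p : bihomog A B p -> component A B p = p.
Proof.
move=> pAB; apply/mpolyP => m; rewrite mcoeff_component.
case: ifP => // mAB; apply/esym/eqP; rewrite mcoeff_eq0.
by apply: contraFN mAB => /pAB ->.
Qed.

(** The form in which bihomogeneity is visibly compatible with products. *)
Lemma bihomogP A B p : bihomog A B p <->
  bigrade p = 'X^A * ('X^B)%:P * p%:P%:P.
Proof.
split=> [pAB | pE]; last first.
  suff <- : component A B p = p by apply: bihomog_component.
  rewrite /component pE -mulrA !coefXnM ltnn subnn coefCM coefXnM ltnn subnn.
  by rewrite !coefC.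
pose R q := bigrade q = 'X^A * ('X^B)%:P * q%:P%:P.
rewrite -/(R p) [p]mpolyE big_seq; apply: (big_ind R) => [|x y Rx Ry|m mp].
- by rewrite /R rmorph0 !polyC0 mulr0.
- by rewrite /R in Rx Ry *; rewrite rmorphD /= Rx Ry !polyCD mulrDr.
rewrite /R bigradeZ bigradeX (pAB m mp) /= -mul_mpolyC !polyCM.
by rewrite mulrCA.
Qed.

Lemma bihomogM A B C E p q :
  bihomog A B p -> bihomog C E q -> bihomog (A + C) (B + E) (p * q).
Proof.
move=> /bihomogP pE /bihomogP qE; apply/bihomogP.
by rewrite rmorphM /= pE qE mulrACA [X in X * _]mulrACA !exprD !polyCM.
Qed.

Lemma bihomog0 A B : bihomog A B (0 : P).
Proof. by apply/bihomogP; rewrite rmorph0 !polyC0 mulr0. Qed.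

Lemma bihomogD A B p q : bihomog A B p -> bihomog A B q -> bihomog A B (p + q).
Proof.
move=> /bihomogP pE /bihomogP qE; apply/bihomogP.
by rewrite rmorphD /= pE qE !polyCD mulrDr.
Qed.

Lemma bihomogZ A B c p : bihomog A B p -> bihomog A B (c *: p).
Proof.
move=> /bihomogP pE; apply/bihomogP.
by rewrite bigradeZ /= pE -mul_mpolyC !polyCM mulrCA.
Qed.

Lemma bihomogN A B p : bihomog A B p -> bihomog A B (- p).
Proof. by rewrite -scaleN1r; apply: bihomogZ. Qed.

Lemma bihomogB A B p q : bihomog A B p -> bihomog A B q -> bihomog A B (p - q).
Proof. by move=> pAB qAB; apply: bihomogD => //; apply: bihomogN. Qed.

Lemma bihomog_sum A B (I : eqType) (r : seq I) (F : I -> P) :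
  (forall x, x \in r -> bihomog A B (F x)) -> bihomog A B (\sum_(x <- r) F x).
Proof.
move=> FAB; rewrite big_seq; apply: (big_ind (bihomog A B)).
- exact: bihomog0.
- exact: bihomogD.
exact: FAB.
Qed.

Lemma bihomog1 : @bihomog K n 0 0 1.
Proof. by apply/bihomogP; rewrite rmorph1 !mul1r. Qed.

Lemma bihomog_tvar i : @bihomog K n 1 0 (tvar K i).
Proof.
apply/bihomogP; rewrite [bigrade _]subst_tvar; congr (_ * _).
by rewrite expr0 mulr1.
Qed.

Lemma bihomog_xvar i : @bihomog K n 0 1 (xvar K i).
Proof.
apply/bihomogP; rewrite [bigrade _]subst_xvar; congr (_ * _).
by rewrite expr0 mul1r.
Qed.

Lemma bihomogX A B p k : bihomog A B p -> bihomog (k * A) (k * B) (p ^+ k).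
Proof.
move=> pAB; elim: k => [|k IHk]; first exact: bihomog1.
by rewrite exprS !mulSn; apply: bihomogM.
Qed.

(** Components of a product with a bihomogeneous factor need no convolution. *)
Lemma componentM A B C E p q : bihomog A B p ->
  component C E (p * q) =
  if (A <= C)%N && (B <= E)%N then p * component (C - A) (E - B) q else 0.
Proof.
move=> /bihomogP pE; rewrite /component rmorphM /= pE -!mulrA coefXnM ltnNge.
case: leqP => /= leAC; last by rewrite coef0.
by rewrite coefCM coefXnM ltnNge coefCM; case: leqP => //= leBE; rewrite coefCM.
Qed.

Lemma component_diag_ideal i j A B p :
  diag_ideal i j p -> diag_ideal i j (component A B p).
Proof.
elim/ideal_mul_ind: p / => [|p q Ip Iq|c g _ Sg].
- by rewrite /component rmorph0 !coef0; apply: ideal_gen0.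
- by rewrite componentD; apply: ideal_genD.
have [C [E gCE]] : exists C E, bihomog C E g.
  case: Sg => ->.
    by exists 1%N, 0%N; apply: bihomogB; apply: bihomog_tvar.
  by exists 0%N, 1%N; apply: bihomogB; apply: bihomog_xvar.
rewrite mulrC (componentM _ _ _ gCE); case: ifP => _; last exact: ideal_gen0.
by rewrite mulrC; apply: ideal_genMl; apply: ideal_gen_mem.
Qed.

(** The diagonal ideals have bihomogeneous generators.  The two coefficient
    extractions make a component of a product a sum of products of
    components, which carries the induction. *)
Lemma component_ideal_pow i j k A B p :
  ideal_pow (diag_ideal i j) k p ->
  ideal_pow (diag_ideal i j) k (component A B p).
Proof.
elim: k p A B => // k IHk p A B.
elim/ideal_mul_ind: p / => [|p q Ip Iq|p q Ip Iq].
- by rewrite /component rmorph0 !coef0; apply: (@ideal_pow0 _ _ k.+1).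
- by rewrite componentD; apply: (@ideal_powD _ _ k.+1).
rewrite /component rmorphM coefM coef_sum.
apply: (big_ind (ideal_pow (@diag_ideal K n i j) k.+1)) => [|x y Ix Iy|C _].
- exact: ideal_pow0.
- exact: ideal_powD.
rewrite coefM; apply: (big_ind (ideal_pow (@diag_ideal K n i j) k.+1)).
- exact: ideal_pow0.
- by move=> x y; apply: ideal_powD.
by move=> E _; apply: ideal_mul_mem; [apply: component_diag_ideal | apply: IHk].
Qed.

End Components.

(** * The collinearity minor and products of linear forms *)

Definition o0 : 'I_3 := @Ordinal 3 0 isT.
Definition o1 : 'I_3 := @Ordinal 3 1 isT.
Definition o2 : 'I_3 := @Ordinal 3 2 isT.

Section LinearForms.
Variable K : fieldType.
Local Notation P := {mpoly K[3 + 3]}.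
Local Open Scope classical_set_scope.
Implicit Types (p q : P) (c : K * K) (ws : seq (K * K)).

(** Twice the signed area of the triangle with vertices [(t_i, x_i)]: the
    determinant of the coordinate differences of consecutive points. *)
Definition disc : P :=
  (tvar K o1 - tvar K o2) * (xvar K o0 - xvar K o1)
  - (tvar K o0 - tvar K o1) * (xvar K o1 - xvar K o2).

(** On a line with parameter, [v o1 - v o2] takes the value [X] and
    [v o0 - v o1 - (v o1 - v o2)] the value [1] in the normalization of [place]
    below; the form therefore takes the value [line_value c]. *)
Definition line_form (v : 'I_3 -> P) c : P :=
  c.1 *: (v o1 - v o2) + c.2 *: (v o0 - v o1 - (v o1 - v o2)).

Local Notation tform := (line_form (@tvar K 3)).
Local Notation xform := (line_form (@xvar K 3)).

(** The same linear polynomials [c.1 X + c.2] may be lifted to the [t] or to the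
    [x] coordinates; here the first [k] of them are lifted to [t].  Modulo
    [disc] only [k] and the multiset [ws] matter. *)
Fixpoint mixed_prod k ws : P :=
  if ws is c :: ws' then
    if k is k'.+1 then tform c * mixed_prod k' ws'
    else xform c * mixed_prod 0 ws'
  else 1.

Definition disc_congr p q := exists r, p - q = disc * r.

Lemma disc_congr_refl p : disc_congr p p.
Proof. by exists 0; rewrite subrr mulr0. Qed.

Lemma disc_congr_trans p q r :
  disc_congr p q -> disc_congr q r -> disc_congr p r.
Proof.
move=> [f pq] [g qr]; exists (f + g).
by rewrite mulrDr -pq -qr addrA subrK.
Qed.

Lemma disc_congrMl p q r : disc_congr p q -> disc_congr (r * p) (r * q).
Proof. by move=> [f pq]; exists (r * f); rewrite -mulrBr pq mulrCA. Qed.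

(** A 2 by 2 minor of products is the product of the minors. *)
Lemma line_form_minor c c' :
  disc_congr (tform c * xform c') (tform c' * xform c).
Proof.
have minor (A : comNzRingType) (a b d e u v y z : A) :
    (a * u + b * (v - u)) * (d * y + e * (z - y))
    - (d * u + e * (v - u)) * (a * y + b * (z - y))
    = (u * z - v * y) * (a * e - b * d) by ring.
exists ((c.1 * c'.2 - c.2 * c'.1)%:MP).
rewrite /line_form -!mul_mpolyC minor; congr (_ * _).
by rewrite mpolyCB !mpolyCM.
Qed.

Lemma mixed_prod_swap k c c' ws :
  disc_congr (mixed_prod k [:: c, c' & ws]) (mixed_prod k [:: c', c & ws]).
Proof.
case: k => [|[|k]] /=.
- by rewrite mulrCA; apply: disc_congr_refl.
- rewrite !mulrA -[X in disc_congr X]mulrC -[X in disc_congr _ X]mulrC.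
  exact/disc_congrMl/line_form_minor.
by rewrite mulrCA; apply: disc_congr_refl.
Qed.

Lemma mixed_prod_cons k c ws ws' :
    (forall l, disc_congr (mixed_prod l ws) (mixed_prod l ws')) ->
  disc_congr (mixed_prod k (c :: ws)) (mixed_prod k (c :: ws')).
Proof. by move=> wsws'; case: k => [|k]; apply: disc_congrMl. Qed.

(** Adjacent transpositions suffice, and they have an effect only at the
    boundary between [t] and [x], where [line_form_minor] is used. *)
Lemma mixed_prod_perm k ws ws' :
  perm_eq ws ws' -> disc_congr (mixed_prod k ws) (mixed_prod k ws').
Proof.
elim: ws ws' k => [|c ws IHws] ws' k eq_ws.
  by move: eq_ws; rewrite perm_sym => /perm_nilP->; apply: disc_congr_refl.
have cws' : c \in ws' by rewrite -(perm_mem eq_ws) mem_head.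
case/splitPr: cws' eq_ws => s1 s2 eq_ws.
have {}eq_ws : perm_eq ws (s1 ++ s2).
  rewrite -(perm_cons c); apply: perm_trans eq_ws _.
  by rewrite (perm_catCA s1 [:: c] s2).
apply: (disc_congr_trans (mixed_prod_cons k c (fun l => IHws _ l eq_ws))).
elim: s1 k {eq_ws IHws} => [|d s1 IHs1] k; first exact: disc_congr_refl.
apply: (disc_congr_trans (mixed_prod_swap k c d _)).
exact: (mixed_prod_cons _ _ IHs1).
Qed.

Lemma mixed_prod_rcons k ws c : (k <= size ws)%N ->
  mixed_prod k (rcons ws c) = xform c * mixed_prod k ws.
Proof.
elim: ws k => [|d ws IHws] [|k] //= lekn; first by rewrite IHws // mulrCA.
by rewrite IHws // mulrCA.
Qed.

Lemma bihomog_line_form A B v c : (forall i, bihomog A B (v i)) ->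
  bihomog A B (line_form v c).
Proof.
move=> vAB; apply: bihomogD; apply: bihomogZ; first exact: bihomogB.
by apply: bihomogB; apply: bihomogB.
Qed.

Lemma bihomog_mixed_prod k ws : (k <= size ws)%N ->
  bihomog k (size ws - k) (mixed_prod k ws).
Proof.
elim: ws k => [|c ws IHws] [|k] //= lekn; first exact: bihomog1.
  have xh : bihomog 0 1 (xform c).
    by apply: bihomog_line_form => i; apply: bihomog_xvar.
  by have := bihomogM xh (IHws 0%N isT); rewrite !subn0 add1n.
have th : bihomog 1 0 (tform c).
  by apply: bihomog_line_form => i; apply: bihomog_tvar.
by have := bihomogM th (IHws k lekn); rewrite subSS.
Qed.

(** Each factor [c] vanishes on the diagonal, whichever group of variables it
    is lifted to. *)
Lemma mixed_prod_mem_pow i j k c ws :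
    diag_ideal i j (tform c) -> diag_ideal i j (xform c) ->
  ideal_pow (diag_ideal i j) (count (pred1 c) ws) (mixed_prod k ws).
Proof.
move=> It Ix; elim: ws k => [|d ws IHws] k //=.
case: eqP => [->|_] /=; last by case: k => [|k]; apply: ideal_powMl.
by case: k => [|k]; apply: ideal_mul_mem.
Qed.

End LinearForms.

(** * Generators of the intersection modulo the minor *)

Section Generators.
Variable K : fieldType.
Local Notation P := {mpoly K[3 + 3]}.
Local Notation tform := (line_form (@tvar K 3)).
Local Notation xform := (line_form (@xvar K 3)).
Local Open Scope classical_set_scope.
Implicit Types (p q : P) (a b e A B : nat) (x : nat * nat * nat).

(** The conditions imposed on the restriction to a line: the parameter
    differences of the pairs 23, 12 and 13 with their multiplicities. *)
Definition points a b : seq (K * K) :=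
  nseq b (1, 0) ++ nseq a (1, 1) ++ nseq a (2%:R, 1).

Lemma size_points a b : size (points a b) = (a.*2 + b)%N.
Proof. by rewrite !size_cat !size_nseq addnC -addnn. Qed.

(** The index [(i, j, k)] stands for the part of bidegree [(i, j)] in the
    differences, that is of bidegree [(A - i, B - j)] in [tvar o2] and
    [xvar o2], and for the power [X^k] of the line parameter.  As [e] is the
    degree forced by [points], there are [i + j + 1 - e] powers left, none if
    this is negative. *)
Definition gen_index e A B : seq (nat * nat * nat) :=
  [seq (ij, k) | ij <- [seq (i, j) | i <- iota 0 A.+1, j <- iota 0 B.+1],
                 k <- iota 0 ((ij.1 + ij.2).+1 - e)].

Lemma mem_gen_index e A B i j k : ((i, j, k) \in gen_index e A B) =
  [&& (i <= A)%N, (j <= B)%N & (k < (i + j).+1 - e)%N].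
Proof.
apply/allpairsPdep/and3P => [[ij [l [ijAB lk [ijE ->]]]] | [leiA lejB ltk]].
  move: ijAB lk; rewrite -ijE mem_iota => /allpairsP[[u v] [uA vB [-> ->]]].
  by move: uA vB; rewrite !mem_iota !add0n !ltnS => /andP[_ ->] /andP[_ ->].
exists (i, j), k; split; rewrite ?mem_iota //.
by apply/allpairsP; exists (i, j); rewrite !mem_iota /= !add0n !ltnS leiA lejB.
Qed.

Lemma gen_index_uniq e A B : uniq (gen_index e A B).
Proof.
apply: allpairs_uniq_dep => [|x _|]; rewrite ?iota_uniq //.
  by apply: allpairs_uniq; rewrite ?iota_uniq // => -[? ?] [? ?].
by move=> [x k] [y l] _ _ /= [-> ->].
Qed.

Lemma size_gen_index e A B : size (gen_index e A B) =
  (\sum_(i < A.+1) \sum_(j < B.+1) ((i + j).+1 - e))%N.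
Proof.
have iotaE n (F : nat -> nat) : (\sum_(i <- iota 0 n) F i = \sum_(i < n) F i)%N.
  by rewrite -(big_mkord xpredT F) /index_iota subn0.
rewrite size_allpairs_dep sumnE big_map big_allpairs iotaE.
apply: eq_bigr => i _; rewrite iotaE; apply: eq_bigr => j _.
by rewrite size_iota.
Qed.

Definition gen_word a b x : seq (K * K) :=
  (nseq x.2 (1, 0) ++ nseq (x.1.1 + x.1.2 - (a.*2 + b) - x.2)%N (0, 1))
  ++ points a b.

(** Its restriction to collinear triples is a power of the position of the last
    point times [line_points * X^k]; see [rank1_restrict_gen]. *)
Definition gen a b A B x : P :=
  tvar K o2 ^+ (A - x.1.1) * xvar K o2 ^+ (B - x.1.2)
  * mixed_prod x.1.1 (gen_word a b x).

Lemma size_gen_word a b i j k : (k < (i + j).+1 - (a.*2 + b))%N ->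
  size (gen_word a b (i, j, k)) = (i + j)%N.
Proof.
by move=> ltk; rewrite size_cat size_points size_cat !size_nseq /=; lia.
Qed.

Lemma bihomog_gen a b A B x : x \in gen_index (a.*2 + b) A B ->
  bihomog A B (gen a b A B x).
Proof.
case: x => [[i j] k]; rewrite mem_gen_index => /and3P[leiA lejB ltk].
have th : bihomog (A - i)%N 0 (tvar K o2 ^+ (A - i)).
  have := bihomogX (k := (A - i)%N) (@bihomog_tvar K _ o2).
  by rewrite muln1 muln0.
have xh : bihomog 0 (B - j)%N (xvar K o2 ^+ (B - j)).
  have := bihomogX (k := (B - j)%N) (@bihomog_xvar K _ o2).
  by rewrite muln1 muln0.
have gh : bihomog i j (mixed_prod i (gen_word a b (i, j, k))).
  have := @bihomog_mixed_prod K i (gen_word a b (i, j, k)).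
  by rewrite size_gen_word // addKn; apply; apply: leq_addr.
have := bihomogM (bihomogM th xh) gh.
by rewrite addn0 add0n !subnK.
Qed.

Definition spans a b A B p := exists f q,
  p = \sum_(x <- gen_index (a.*2 + b) A B) f x *: gen a b A B x + @disc K * q.

Lemma spansD a b A B p q :
  spans a b A B p -> spans a b A B q -> spans a b A B (p + q).
Proof.
move=> [f [r ->]] [g [s ->]]; exists (fun x => f x + g x), (r + s).
rewrite mulrDr addrACA -big_split; congr (_ + _).
by apply: eq_bigr => x _; rewrite scalerDl.
Qed.

Lemma spans_disc a b A B q : spans a b A B (@disc K * q).
Proof.
exists (fun=> 0), q; rewrite big1 ?add0r // => x _; exact: scale0r.
Qed.

Lemma spans0 a b A B : spans a b A B 0.
Proof. by rewrite -(mulr0 (@disc K)); apply: spans_disc. Qed.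

Lemma spansZ a b A B c p : spans a b A B p -> spans a b A B (c *: p).
Proof.
move=> [f [r ->]]; exists (fun x => c * f x), (c *: r).
rewrite scalerDr scaler_sumr scalerAr; congr (_ + _).
by apply: eq_bigr => x _; rewrite scalerA.
Qed.

Lemma spans_congr a b A B p q :
  disc_congr p q -> spans a b A B q -> spans a b A B p.
Proof.
by move=> [r pq] qs; rewrite -(subrK q p) pq; apply: spansD => //;
  apply: spans_disc.
Qed.

Lemma spans_gen a b A B x :
  x \in gen_index (a.*2 + b) A B -> spans a b A B (gen a b A B x).
Proof.
move=> xI; exists (fun y => (y == x)%:R), 0.
rewrite mulr0 addr0 (bigD1_seq x) ?gen_index_uniq //= eqxx scale1r.
by rewrite big1 ?addr0 // => y /negPf ->; apply: scale0r.
Qed.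

Lemma spans_sum a b A B (I : eqType) (r : seq I) (F : I -> P) :
  (forall y, y \in r -> spans a b A B (F y)) ->
  spans a b A B (\sum_(y <- r) F y).
Proof.
move=> Fs; rewrite big_seq; apply: (big_ind (spans a b A B)) => //.
- exact: spans0.
- exact: spansD.
Qed.

(** Multiplication by a fixed element that maps every generator into the span
    of the generators maps the whole span there. *)
Lemma spans_mul a b A B A' B' r p :
    (forall x, x \in gen_index (a.*2 + b) A B ->
       spans a b A' B' (r * gen a b A B x)) ->
  spans a b A B p -> spans a b A' B' (r * p).
Proof.
move=> rgen [f [q ->]]; rewrite mulrDr mulrCA; apply: spansD; last first.
  exact: spans_disc.
rewrite mulr_sumr; apply: spans_sum => x xI.
by rewrite -scalerAr; apply: spansZ; apply: rgen.
Qed.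

Lemma spans_t2 A B p : spans 0 0 A B p -> spans 0 0 A.+1 B (tvar K o2 * p).
Proof.
apply: spans_mul => -[[i j] k]; rewrite mem_gen_index => /and3P[leiA lejB ltk].
rewrite /gen !mulrA -exprS -subSn //.
by apply: (@spans_gen 0 0 A.+1 B (i, j, k)); rewrite mem_gen_index leqW ?lejB.
Qed.

Lemma spans_x2 A B p : spans 0 0 A B p -> spans 0 0 A B.+1 (xvar K o2 * p).
Proof.
apply: spans_mul => -[[i j] k]; rewrite mem_gen_index => /and3P[leiA lejB ltk].
rewrite /gen mulrA mulrCA -exprS -subSn //.
by apply: (@spans_gen 0 0 A B.+1 (i, j, k)); rewrite mem_gen_index leiA leqW.
Qed.

Lemma gen_word00 i j k : gen_word 0 0 (i, j, k) =
  nseq k (1, 0) ++ nseq (i + j - k)%N (0, 1).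
Proof. by rewrite /gen_word /points /= subn0 cats0. Qed.

(** For [l = 1] the new factor is the form with value [X], for [l = 0] the one
    with value [1]; both cases keep the word sorted up to permutation. *)
Lemma perm_gen_word00 l i j k : (k < (i + j).+1)%N ->
  (l <= 1)%N ->
  perm_eq ((l%:R, 1 - l%:R) :: gen_word 0 0 (i, j, k))
     (nseq (l + k)%N (1, 0) ++ nseq ((i + j).+1 - (l + k))%N (0, 1)).
Proof.
rewrite gen_word00; case: l => [|[|//]] ltk _.
  rewrite mulr0n subr0 add0n subSn //.
  by rewrite (perm_catCA [:: (0, 1)] _ _).
by rewrite mulr1n subrr add1n subSS.
Qed.

Lemma spans_tform l A B p : (l <= 1)%N -> spans 0 0 A B p ->
  spans 0 0 A.+1 B (tform (l%:R, 1 - l%:R) * p).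
Proof.
move=> lel1; apply: spans_mul => -[[i j] k].
rewrite mem_gen_index subn0 => /and3P[leiA lejB ltk].
have xI : (i.+1, j, (l + k)%N) \in gen_index 0 A.+1 B.
  by rewrite mem_gen_index ltnS leiA lejB subn0; lia.
apply: spans_congr (@spans_gen 0 0 A.+1 B _ xI); rewrite /gen /= subSS mulrCA.
apply: disc_congrMl; rewrite -/(mixed_prod i.+1 (_ :: _)).
apply: mixed_prod_perm; rewrite [X in perm_eq _ X]gen_word00 addSn.
exact: perm_gen_word00.
Qed.

Lemma spans_xform l A B p : (l <= 1)%N -> spans 0 0 A B p ->
  spans 0 0 A B.+1 (xform (l%:R, 1 - l%:R) * p).
Proof.
move=> lel1; apply: spans_mul => -[[i j] k].
rewrite mem_gen_index subn0 => /and3P[leiA lejB ltk].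
have xI : (i, j.+1, (l + k)%N) \in gen_index 0 A B.+1.
  by rewrite mem_gen_index ltnS leiA lejB subn0; lia.
apply: spans_congr (@spans_gen 0 0 A B.+1 _ xI); rewrite /gen /= subSS mulrCA.
apply: disc_congrMl; rewrite -mixed_prod_rcons; last first.
  by rewrite size_gen_word ?subn0 // leq_addr.
apply: mixed_prod_perm; rewrite perm_rcons [X in perm_eq _ X]gen_word00 addnS.
exact: perm_gen_word00.
Qed.

End Generators.

Section Spanning.
Variable K : fieldType.
Local Notation P := {mpoly K[3 + 3]}.
Implicit Types (p q : P) (a b e A B : nat).

Lemma I3P (i : 'I_3) : [\/ i = o0, i = o1 | i = o2].
Proof.
by case: i => [[|[|[|//]]] lti];
  [apply: Or31 | apply: Or32 | apply: Or33]; apply: val_inj.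
Qed.

Lemma line_form10 (v : 'I_3 -> P) :
  line_form v (1%:R, 1 - 1%:R) = v o1 - v o2.
Proof. by rewrite /line_form /= mulr1n subrr scale0r addr0 scale1r. Qed.

Lemma line_form01 (v : 'I_3 -> P) :
  line_form v (0%:R, 1 - 0%:R) = v o0 - v o1 - (v o1 - v o2).
Proof. by rewrite /line_form /= mulr0n subr0 scale0r add0r scale1r. Qed.

(** The three variables [v o0], [v o1], [v o2] are combinations of [v o2] and of
    the two basic linear forms. *)
Lemma spans_var (v : 'I_3 -> P) A B A' B' p i :
    spans 0 0 A' B' (v o2 * p) ->
    (forall l, (l <= 1)%N ->
       spans 0 0 A' B' (line_form v (l%:R, 1 - l%:R) * p)) ->
  spans 0 0 A' B' (v i * p).
Proof.
move=> v2 vl; have v1 : spans 0 0 A' B' (v o1 * p).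
  rewrite -(subrK (v o2) (v o1)) mulrDl -line_form10.
  by apply: spansD v2; apply: vl.
case: (I3P i) => -> //.
rewrite -(subrK (v o1) (v o0)) mulrDl -(subrK (v o1 - v o2) (v o0 - v o1)).
rewrite mulrDl -line_form01 -line_form10.
by apply: spansD v1; apply: spansD; apply: vl.
Qed.

Lemma spans_tvar i A B p :
  spans 0 0 A B p -> spans 0 0 A.+1 B (tvar K i * p).
Proof.
move=> sp; apply: (spans_var (v := @tvar K 3) 0 0); first exact: spans_t2.
by move=> l lel1; apply: spans_tform.
Qed.

Lemma spans_xvar i A B p :
  spans 0 0 A B p -> spans 0 0 A B.+1 (xvar K i * p).
Proof.
move=> sp; apply: (spans_var (v := @xvar K 3) 0 0); first exact: spans_x2.
by move=> l lel1; apply: spans_xform.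
Qed.

Lemma spans_tvarX i k A B p :
  spans 0 0 A B p -> spans 0 0 (k + A) B (tvar K i ^+ k * p).
Proof.
move=> sp; elim: k => [|k IHk]; first by rewrite mul1r.
by rewrite exprS -mulrA addSn; apply: spans_tvar.
Qed.

Lemma spans_xvarX i k A B p :
  spans 0 0 A B p -> spans 0 0 A (k + B) (xvar K i ^+ k * p).
Proof.
move=> sp; elim: k => [|k IHk]; first by rewrite mul1r.
by rewrite exprS -mulrA addSn; apply: spans_xvar.
Qed.

Lemma spans_monomial (m : 'X_{1..3 + 3}) :
  @spans K 0 0 (bidegree m).1 (bidegree m).2 'X_[m].
Proof.
have sx : spans 0 0 0 (\sum_(i < 3) m (rshift 3 i))
    (\prod_(i < 3) xvar K i ^+ m (rshift 3 i)).
  elim/big_rec2: _ => [|i p k _ sp]; last exact: spans_xvarX.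
  have -> : 1 = gen K 0 0 0 0 (0%N, 0%N, 0%N) :> P.
    by rewrite /gen /= !expr0 !mulr1.
  by apply: spans_gen; rewrite mem_gen_index.
rewrite /bidegree /=.
have -> : 'X_[m] = \prod_(i < 3) tvar K i ^+ m (lshift 3 i) *
    \prod_(i < 3) xvar K i ^+ m (rshift 3 i).
  by rewrite mpolyXE_id big_split_ord.
move: (\sum_(i < 3) m (rshift 3 i))%N (\prod_(i < 3) xvar K i ^+ _) sx.
move=> B p sp.
elim/big_rec2: _ => [|i q k _ sq]; first by rewrite mul1r.
by rewrite -mulrA; apply: spans_tvarX.
Qed.

(** Straightening: without any vanishing condition, the generators and the
    multiples of [disc] exhaust the bihomogeneous polynomials.  Multiplication
    by a variable preserves this, so monomials are reached one variable at a
    time. *)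
Lemma spans_bihomog A B p : bihomog A B p -> spans 0 0 A B p.
Proof.
move=> pAB; rewrite [p]mpolyE; apply: spans_sum => m mp.
by apply: spansZ; have := spans_monomial m; rewrite (pAB m mp).
Qed.

End Spanning.

(** * Restriction to collinear triples *)

Section Restriction.
Variable K : fieldType.
Local Notation P := {mpoly K[3 + 3]}.
Local Notation tform := (line_form (@tvar K 3)).
Local Notation xform := (line_form (@xvar K 3)).
Implicit Types (p q : P) (a b e A B : nat) (c : K * K).

(** The parameters of the three points on a line.  They are chosen so that the
    three differences [X], [X + 1], [2 X + 1] have distinct finite roots: no
    information is lost at infinity, and degrees count correctly, when
    2 is invertible. *)
Definition place (i : 'I_3) : {poly K} := nth 0 [:: 2%:R *: 'X + 1; 'X; 0] i.

(** Restriction to triples of points on a line.  The outer two indeterminates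
    are the coordinates of the last point.  The direction of the line is
    normalized to [(1, 1)], which loses nothing on bihomogeneous polynomials
    since the two coordinates can be rescaled independently. *)
Definition rank1_restrict : P -> {poly {poly {poly K}}} :=
  subst (@polyC {poly {poly K}} \o (@polyC {poly K} \o @polyC K))
    (fun i => 'X + (place i)%:P%:P)
    (fun i => 'X%:P + (place i)%:P%:P).

HB.instance Definition _ := GRing.RMorphism.on rank1_restrict.

Lemma rank1_restrictZ d p :
  rank1_restrict (d *: p) = d%:P%:P%:P * rank1_restrict p.
Proof. exact: substZ. Qed.

Lemma rank1_restrictM : {morph rank1_restrict : p q / p * q}.
Proof. exact: rmorphM. Qed.

Lemma rank1_restrictD : {morph rank1_restrict : p q / p + q}.
Proof. exact: rmorphD. Qed.

Lemma rank1_restrictB : {morph rank1_restrict : p q / p - q}.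
Proof. exact: rmorphB. Qed.

Lemma rank1_restrict_subt i j :
  rank1_restrict (tvar K i - tvar K j) = (place i - place j)%:P%:P.
Proof.
rewrite rank1_restrictB ![rank1_restrict _]subst_tvar !polyCB opprD addrACA.
by rewrite subrr add0r.
Qed.

Lemma rank1_restrict_subx i j :
  rank1_restrict (xvar K i - xvar K j) = (place i - place j)%:P%:P.
Proof.
rewrite rank1_restrictB ![rank1_restrict _]subst_xvar !polyCB opprD addrACA.
by rewrite subrr add0r.
Qed.

Lemma rank1_restrict_disc : rank1_restrict (@disc K) = 0.
Proof.
rewrite /disc rank1_restrictB !rank1_restrictM.
rewrite !rank1_restrict_subt !rank1_restrict_subx.
by rewrite mulrC subrr.
Qed.

Definition line_value c : {poly K} := c.1 *: 'X + c.2%:P.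

Lemma line_valueE c : line_value c =
  c.1%:P * (place o1 - place o2)
  + c.2%:P * (place o0 - place o1 - (place o1 - place o2)).
Proof.
by rewrite /line_value /place /= -mul_polyC subr0 -mul_polyC; ring.
Qed.

Lemma rank1_restrict_tform c : rank1_restrict (tform c) = (line_value c)%:P%:P.
Proof.
rewrite /line_form rank1_restrictD !rank1_restrictZ [X in _ + _ * X]rank1_restrictB.
rewrite !rank1_restrict_subt line_valueE.
by rewrite !(polyCD, polyCN, polyCM).
Qed.

Lemma rank1_restrict_xform c : rank1_restrict (xform c) = (line_value c)%:P%:P.
Proof.
rewrite /line_form rank1_restrictD !rank1_restrictZ [X in _ + _ * X]rank1_restrictB.
rewrite !rank1_restrict_subx line_valueE.
by rewrite !(polyCD, polyCN, polyCM).
Qed.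

Lemma rank1_restrict_mixed_prod k ws :
  rank1_restrict (mixed_prod k ws) = (\prod_(c <- ws) line_value c)%:P%:P.
Proof.
elim: ws k => [|c ws IHws] k /=; first by rewrite rmorph1 big_nil.
rewrite big_cons !polyCM; case: k => [|k]; rewrite rank1_restrictM IHws.
  by rewrite rank1_restrict_xform.
by rewrite rank1_restrict_tform.
Qed.

(** The value of the word [points] on the line. *)
Definition line_points a b : {poly K} :=
  'X ^+ b * (('X + 1) ^+ a * (2%:R *: 'X + 1) ^+ a).

Lemma rank1_restrict_gen a b A B x : rank1_restrict (gen K a b A B x) =
  'X^(A - x.1.1) * ('X^(B - x.1.2) * (line_points a b * 'X ^+ x.2)%:P)%:P.
Proof.
have prod_nseq m c : \prod_(d <- nseq m c) line_value d = line_value c ^+ m.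
  by elim: m => [|m IHm] /=; rewrite ?big_nil // big_cons IHm exprS.
rewrite /gen !rank1_restrictM !rmorphXn /= rank1_restrict_mixed_prod.
rewrite [rank1_restrict _]subst_tvar [rank1_restrict _]subst_xvar /place /= !addr0.
rewrite -mulrA -polyC_exp -polyCM; congr (_ * (_ * _%:P)%:P).
rewrite /gen_word /points !big_cat /= !prod_nseq /line_points.
rewrite /line_value /= !scale1r scale0r add0r !polyC1 expr1n mulr1.
by rewrite addr0 mulrC.
Qed.

End Restriction.

Section Decomposition.
Variable K : fieldType.
Local Notation P := {mpoly K[3 + 3]}.
Local Notation tform := (line_form (@tvar K 3)).
Local Notation xform := (line_form (@xvar K 3)).
Local Open Scope classical_set_scope.
Implicit Types (p q : P) (a b e A B i j k : nat) (c : K * K).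

(** The intersection ideal of the theorem for [a <= b], see [Jprime3E].  It
    is used for all [a] and [b] since both decrease in the recursion. *)
Definition diag_inter a b : set P := [set p |
  [/\ ideal_pow (diag_ideal o1 o2) b p, ideal_pow (diag_ideal o0 o1) a p
    & ideal_pow (diag_ideal o0 o2) a p]].

Lemma diag_interD a b p q :
  diag_inter a b p -> diag_inter a b q -> diag_inter a b (p + q).
Proof. by move=> [? ? ?] [? ? ?]; split; apply: ideal_powD. Qed.

Lemma diag_interM a b p q : diag_inter a b q -> diag_inter a b (p * q).
Proof. by move=> [? ? ?]; split; apply: ideal_powMl. Qed.

Lemma diag_inter0 a b : diag_inter a b 0.
Proof. by split; apply: ideal_pow0. Qed.

Lemma diag_interZ a b (d : K) p : diag_inter a b p -> diag_inter a b (d *: p).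
Proof. by rewrite -mul_mpolyC; apply: diag_interM. Qed.

Lemma diag_inter_sum a b (I : Type) (r : seq I) (F : I -> P) :
  (forall x, diag_inter a b (F x)) -> diag_inter a b (\sum_(x <- r) F x).
Proof.
move=> Fab; apply: (big_ind (diag_inter a b)) => //.
- exact: diag_inter0.
- exact: diag_interD.
Qed.

Lemma diag_interB a b p q :
  diag_inter a b p -> diag_inter a b q -> diag_inter a b (p - q).
Proof.
move=> pab qab; rewrite -scaleN1r.
by apply: diag_interD => //; apply: diag_interZ.
Qed.

Lemma component_diag_inter a b A B p :
  diag_inter a b p -> diag_inter a b (component A B p).
Proof. by move=> [? ? ?]; split; apply: component_ideal_pow. Qed.

(** The monomial [t2 x1] occurs in exactly one of the expanded products. *)
Lemma disc_neq0 : @disc K != 0.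
Proof.
have tx (i j : 'I_3) :
    tvar K i * xvar K j = 'X_[U_(lshift 3 i) + U_(rshift 3 j)].
  by rewrite mpolyXD.
pose m := (U_(lshift 3 o1) + U_(rshift 3 o0))%MM.
suff : (@disc K)@_m != 0 by apply: contraNneq => ->; rewrite mcoeff0.
rewrite /disc !(mulrBl, mulrBr) !tx !mcoeffB !mcoeffX.
have mE (i j : 'I_3) :
    (U_(lshift 3 i) + U_(rshift 3 j) == m)%MM = (i == o1) && (j == o0).
  apply/eqP/andP => [/mnmP mm|[/eqP-> /eqP->]] //.
  have := mm (lshift 3 o1); have := mm (rshift 3 o0).
  rewrite !mnmDE !mnm1E !eq_lshift !eq_rshift !eq_lrshift !eq_rlshift !eqxx.
  by case: (i == o1); case: (j == o0).
by rewrite !mE /= !subr0 oner_neq0.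
Qed.

Lemma contract12_disc : contract o1 o2 (@disc K) = 'X * (@disc K)%:P.
Proof.
rewrite /disc !(contractB, contractM, contract_tvar, contract_xvar) /=.
rewrite !(polyCB, polyCM); ring.
Qed.

Lemma contract01_disc : contract o0 o1 (@disc K) = 'X * (@disc K)%:P.
Proof.
rewrite /disc !(contractB, contractM, contract_tvar, contract_xvar) /=.
rewrite !(polyCB, polyCM); ring.
Qed.

Lemma contract02_disc : contract o0 o2 (@disc K) = 'X * (@disc K)%:P.
Proof.
rewrite /disc !(contractB, contractM, contract_tvar, contract_xvar) /=.
rewrite !(polyCB, polyCM); ring.
Qed.

(** The minor vanishes to order exactly one along each of the three diagonals;
    for a zero exponent there is no condition on either side, which is why the
    truncated predecessor is right. *)
Lemma diag_inter_disc a b p :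
  diag_inter a b (@disc K * p) <-> diag_inter a.-1 b.-1 p.
Proof.
have cancel (i j : 'I_3) (ij : i != j) k :=
  @ideal_pow_diag_cancel K 3 i j ij k (@disc K) p disc_neq0.
have c12 k := cancel o1 o2 isT k contract12_disc.
have c01 k := cancel o0 o1 isT k contract01_disc.
have c02 k := cancel o0 o2 isT k contract02_disc.
by split=> -[? ? ?]; split; [apply/c12 | apply/c01 | apply/c02
  | apply/c12 | apply/c01 | apply/c02].
Qed.

(** The word [points] contains each of the three special forms as often as the
    corresponding diagonal requires. *)
Lemma mixed_prod_points_mem a b k ws :
  diag_inter a b (mixed_prod k (ws ++ points K a b)).
Proof.
have mem (i j : 'I_3) l c : (l <= count (pred1 c) (ws ++ points K a b))%N ->
    tform c = tvar K i - tvar K j -> xform c = xvar K i - xvar K j ->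
  ideal_pow (diag_ideal i j) l (mixed_prod k (ws ++ points K a b)).
  move=> lel tE xE; apply: ideal_pow_le lel _.
  apply: mixed_prod_mem_pow; rewrite ?tE ?xE; apply: ideal_gen_mem;
    by [left | right].
have line10 (v : 'I_3 -> P) : line_form v (1, 0) = v o1 - v o2.
  by rewrite /line_form /= scale0r addr0 scale1r.
have line11 (v : 'I_3 -> P) : line_form v (1, 1) = v o0 - v o1.
  by rewrite /line_form /= !scale1r addrC subrK.
have line21 (v : 'I_3 -> P) : line_form v (2%:R, 1) = v o0 - v o2.
  by rewrite /line_form /= scale1r scaler_nat; ring.
split.
- apply: (mem _ _ _ (1, 0)); rewrite ?line10 // !count_cat !count_nseq /= eqxx.
  by rewrite mul1n; lia.
- apply: (mem _ _ _ (1, 1)); rewrite ?line11 // !count_cat !count_nseq /= eqxx.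
  by rewrite mul1n; lia.
apply: (mem _ _ _ (2%:R, 1)); rewrite ?line21 // !count_cat !count_nseq /= eqxx.
by rewrite mul1n; lia.
Qed.

Lemma gen_mem a b A B x : diag_inter a b (gen K a b A B x).
Proof. exact/diag_interM/mixed_prod_points_mem. Qed.

End Decomposition.

Section MainDecomposition.
Variable K : fieldType.
Local Notation P := {mpoly K[3 + 3]}.
Local Open Scope classical_set_scope.
Implicit Types (p q : P) (a b e A B i j k : nat).

Lemma rank1_restrict_ideal_pow (i j : 'I_3) k p :
    ideal_pow (diag_ideal i j) k p ->
  exists g, rank1_restrict p = ((place K i - place K j) ^+ k)%:P%:P * g.
Proof.
have diagE q : diag_ideal i j q ->
    exists g, rank1_restrict q = (place K i - place K j)%:P%:P * g.
  elim/ideal_mul_ind: q / => [|x y [g gE] [h hE]|x y _ Sy].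
  - by exists 0; rewrite rmorph0 mulr0.
  - by exists (g + h); rewrite rank1_restrictD gE hE mulrDr.
  exists (rank1_restrict x); rewrite rank1_restrictM mulrC; congr (_ * _).
  by case: Sy => ->; [apply: rank1_restrict_subt | apply: rank1_restrict_subx].
elim: k p => [|k IHk] p; first by exists (rank1_restrict p); rewrite !polyC1 mul1r.
elim/ideal_mul_ind: p / => [|x y [g gE] [h hE]|x y Ix Iy].
- by exists 0; rewrite rmorph0 mulr0.
- by exists (g + h); rewrite rank1_restrictD gE hE mulrDr.
have [g gE] := diagE _ Ix; have [h hE] := IHk _ Iy.
by exists (g * h); rewrite rank1_restrictM gE hE exprS !polyCM mulrACA.
Qed.

(** The three linear polynomials are pairwise coprime, as Bezout relations with
    integer coefficients show, so divisibility by each power gives divisibility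
    by the product. *)
Lemma line_points_dvd a b p m n :
  diag_inter a b p -> line_points K a b %| (rank1_restrict p)`_m`_n.
Proof.
have pow_dvd (i j : 'I_3) k : ideal_pow (diag_ideal i j) k p ->
    (place K i - place K j) ^+ k %| (rank1_restrict p)`_m`_n.
  by move=> /rank1_restrict_ideal_pow[g ->]; rewrite !coefCM dvdp_mulr.
have coprime_sub1 (r s : {poly K}) u v : u * r + v * s = 1 -> coprimep r s.
  by move=> rs1; apply/Bezout_coprimepP; exists (u, v); rewrite rs1 eqpxx.
have c12 : coprimep ('X : {poly K}) ('X + 1).
  by apply: (coprime_sub1 _ _ (- 1) 1); ring.
have c13 : coprimep ('X : {poly K}) (2%:R *: 'X + 1).
  by apply: (coprime_sub1 _ _ (- 2%:R%:P) 1); rewrite -mul_polyC; ring.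
have c23 : coprimep ('X + 1 : {poly K}) (2%:R *: 'X + 1).
  by apply: (coprime_sub1 _ _ 2%:R%:P (- 1)); rewrite -mul_polyC polyC_natr; ring.
move=> [/pow_dvd p12 /pow_dvd p01 /pow_dvd p02]; rewrite /line_points.
rewrite Gauss_dvdp; last first.
  by rewrite coprimepMr !coprimep_expl // coprimep_expr.
rewrite Gauss_dvdp; last by rewrite coprimep_expl // coprimep_expr.
move: p12 p01 p02; rewrite /place /= !subr0 => -> p01 ->.
move: p01; rewrite (_ : _ - 'X = 'X + 1) ?andbT //.
by rewrite scaler_nat; ring.
Qed.

(** The polynomial in the line parameter contributed by the indices with given
    [i] and [j]. *)
Definition index_slice e A B (f : nat * nat * nat -> K) i j : {poly K} :=
  \sum_(x <- gen_index e A B | x.1 == (i, j)) f x *: 'X ^+ x.2.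

Lemma coef_index_slice e A B f i j k : (i <= A)%N -> (j <= B)%N ->
  (index_slice e A B f i j)`_k =
  if (k < (i + j).+1 - e)%N then f (i, j, k) else 0.
Proof.
move=> leiA lejB; rewrite /index_slice coef_sum.
have -> : (k < (i + j).+1 - e)%N = ((i, j, k) \in gen_index e A B).
  by rewrite mem_gen_index leiA lejB.
rewrite big_mkcond (eq_bigr (fun x => if x == (i, j, k) then f x else 0)).
  case: ifP => [xI | xnI].
    rewrite (bigD1_seq (i, j, k)) ?gen_index_uniq //= eqxx big1 ?addr0 //.
    by move=> x /negPf->.
  rewrite big_seq big1 // => x xI; case: eqP => // xE.
  by rewrite xE xnI in xI.
move=> [x l] _ /=; rewrite coefZ coefXn [in RHS]xpair_eqE.
by case: (x == _) => //=; rewrite eq_sym; case: (l == k); rewrite ?mulr1 ?mulr0.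
Qed.

Lemma rank1_restrict_slice a b A B f i j : (i <= A)%N -> (j <= B)%N ->
  (rank1_restrict (\sum_(x <- gen_index (a.*2 + b) A B)
     f x *: gen K a b A B x))`_(A - i)`_(B - j) =
  line_points K a b * index_slice (a.*2 + b) A B f i j.
Proof.
move=> leiA lejB; rewrite rmorph_sum !coef_sum /index_slice mulr_sumr.
rewrite [RHS]big_mkcond /=; apply: eq_big_seq => -[[i' j'] k].
rewrite mem_gen_index => /and3P[lei'A lej'B _].
rewrite rank1_restrictZ rank1_restrict_gen /= !coefCM coefMC coefXn.
have eq_sub m m' n : (m <= n)%N -> (m' <= n)%N ->
  (n - m == n - m')%N = (m' == m) by move=> *; apply/eqP/eqP; lia.
rewrite eq_sub // xpair_eqE; case: eqP => _ /=; last first.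
  by rewrite mul0r coef0 mulr0.
rewrite mul1r coefMC coefXn eq_sub //; case: eqP => _ /=.
  by rewrite mul1r mul_polyC scalerAr.
by rewrite mul0r mulr0.
Qed.

Lemma index_slice_eq0 e A B f :
    (forall i j, (i <= A)%N -> (j <= B)%N -> index_slice e A B f i j = 0) ->
  forall x, x \in gen_index e A B -> f x = 0.
Proof.
move=> f0 [[i j] k]; rewrite mem_gen_index => /and3P[leiA lejB ltk].
by have := coef_index_slice e f k leiA lejB; rewrite f0 // ltk coef0.
Qed.

Lemma line_points_neq0 a b : line_points K a b != 0.
Proof.
rewrite !mulf_neq0 ?expf_neq0 ?polyX_eq0 //.
  by rewrite -size_poly_eq0 size_XaddC.
apply/eqP => /(congr1 (coefp 0)); rewrite /= coefD coefZ coefX mulr0 coef1.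
by rewrite add0r coef0 => /eqP; rewrite oner_eq0.
Qed.

(** Restriction to collinear triples kills [disc] and separates the generators:
    first by the position of the last point, then by the power of the line
    parameter. *)
Lemma gen_independent a b A B f q :
    \sum_(x <- gen_index (a.*2 + b) A B) f x *: gen K a b A B x = @disc K * q ->
  forall x, x \in gen_index (a.*2 + b) A B -> f x = 0.
Proof.
move=> fq; apply: index_slice_eq0 => i j leiA lejB.
have := rank1_restrict_slice a b f leiA lejB.
rewrite fq rank1_restrictM rank1_restrict_disc mul0r !coef0 => /esym/eqP.
by rewrite mulf_eq0 (negPf (line_points_neq0 a b)) => /eqP.
Qed.

Hypothesis two_neq0 : 2%:R != 0 :> K.

(** Here characteristic 2 would lower the degree of [2 X + 1]. *)
Lemma size_line_points a b : size (line_points K a b) = (a.*2 + b).+1.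
Proof.
have size2 : size (2%:R *: 'X + 1 : {poly K}) = 2.
  by rewrite size_polyDl size_scale ?size_polyX ?size_poly1.
have size1 : size ('X + 1 : {poly K}) = 2 by rewrite size_XaddC.
have := line_points_neq0 a b; rewrite /line_points !mulf_eq0 !negb_or.
move=> /and3P[n1 n2 n3]; rewrite !size_mul ?mulf_neq0 // size_polyXn.
have sizeX (p : {poly K}) m : size p = 2 -> size (p ^+ m) = m.+1.
  move=> p2; have : size (p ^+ m) != 0%N.
    by rewrite size_poly_eq0 expf_neq0 // -size_poly_eq0 p2.
  by have := size_exp p m; rewrite p2 mul1n; case: (size _) => //= k ->.
by rewrite !sizeX //; lia.
Qed.

(** Each coefficient of the restriction of [p] is divided by [line_points]; the
    quotient gives the coefficients [f] of the generators.  The degree bound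
    for the quotient, and the fact that the remaining polynomial, which
    restricts to zero, is a multiple of [disc], both come from expanding with
    [spans_bihomog], where no vanishing is imposed. *)
Lemma diag_inter_spans a b A B p :
  diag_inter a b p -> bihomog A B p -> spans a b A B p.
Proof.
move=> pab pAB.
pose c i j := (rank1_restrict p)`_(A - i)`_(B - j).
pose f (x : nat * nat * nat) := (c x.1.1 x.1.2 %/ line_points K a b)`_x.2.
have slice0 g q r : r = \sum_(x <- gen_index 0 A B) g x *: gen K 0 0 A B x +
      @disc K * q -> forall i j, (i <= A)%N -> (j <= B)%N ->
    (rank1_restrict r)`_(A - i)`_(B - j) = index_slice 0 A B g i j.
  move=> -> i j leiA lejB; rewrite rank1_restrictD rank1_restrictM.
  rewrite rank1_restrict_disc mul0r addr0 (rank1_restrict_slice 0 0) //.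
  by rewrite /line_points !expr0 !mul1r.
have size_c i j : (i <= A)%N -> (j <= B)%N -> (size (c i j) <= (i + j).+1)%N.
  move=> leiA lejB; have [g [q pE]] := spans_bihomog pAB.
  apply/leq_sizeP => k lek.
  by rewrite /c (slice0 g q) // coef_index_slice // subn0 ltnNge lek.
pose r := p - \sum_(x <- gen_index (a.*2 + b) A B) f x *: gen K a b A B x.
have r0 i j : (i <= A)%N -> (j <= B)%N ->
    (rank1_restrict r)`_(A - i)`_(B - j) = 0.
  move=> leiA lejB; rewrite /r rank1_restrictB !coefB rank1_restrict_slice //.
  apply/eqP; rewrite subr_eq0 -/(c i j); apply/eqP.
  rewrite -[LHS](divpK (line_points_dvd (A - i) (B - j) pab)) mulrC.
  congr (_ * _); apply/polyP => k; rewrite coef_index_slice // /f /=.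
  case: ltnP => // lek; apply/leq_sizeP: k lek.
  rewrite size_divp ?line_points_neq0 // size_line_points /=.
  by rewrite leq_sub2r // size_c.
have rAB : bihomog A B r.
  apply: bihomogB => //; apply: bihomog_sum => x xI.
  by apply: bihomogZ; apply: bihomog_gen.
have [g [q rE]] := spans_bihomog rAB.
exists f, q; rewrite addrC -[p](subrK (\sum_(x <- gen_index (a.*2 + b) A B)
  f x *: gen K a b A B x)) -/r; congr (_ + _).
rewrite rE big_seq big1 ?add0r // => x xI.
rewrite (index_slice_eq0 _ xI) ?scale0r // => i j leiA lejB.
by rewrite -(slice0 g q r rE i j leiA lejB) r0.
Qed.

End MainDecomposition.

(** * Dimensions of the bihomogeneous pieces *)

(** The first summand counts the elements of [gen_index], the second one is the
    contribution of [disc * J(a-1, b-1)], as [disc] has bidegree (1, 1). *)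
Fixpoint dim_ideal a b A B {struct A} : nat :=
  ((\sum_(i < A.+1) \sum_(j < B.+1) ((i + j).+1 - (a.*2 + b))) +
   if (A, B) is (A'.+1, B'.+1) then dim_ideal a.-1 b.-1 A' B' else 0)%N.

(** Since the degrees [2(a-k) + (b-k) + 2k] of the successive layers are
    distinct, at most one layer contributes to a given bidegree, and it
    contributes a single element. *)
Fixpoint dim_generators a b A B : nat :=
  if (A + B == a.*2 + b)%N then 1%N else
  if (a, A, B) is (a'.+1, A'.+1, B'.+1) then dim_generators a' b.-1 A' B'
  else 0%N.

Lemma dim_generators_above a b A B :
  (a <= b)%N -> (a.*2 + b < A + B)%N -> dim_generators a b A B = 0%N.
Proof.
elim: a b A B => [|a IHa] b A B leab ltAB /=; rewrite gtn_eqF //.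
case: A ltAB => // A ltAB; case: B ltAB => // B ltAB.
apply: IHa; first by case: b leab {ltAB}.
by case: b leab ltAB => // b; rewrite !doubleS => _; lia.
Qed.

Section Dimensions.
Variables (K : fieldType) (E : lmodType K).
Local Open Scope classical_set_scope.
Implicit Types (V W : set E) (d : nat).

Lemma has_dim_mod0 V W : W 0 -> (V `<=` W) -> has_dim_mod V W 0.
Proof.
move=> W0 VW; exists (fun=> 0); split=> [[]|c _ []|v Vv] //.
by exists (fun=> 0); rewrite big_ord0 subr0; apply: VW.
Qed.

Lemma has_dim_mod1 V W v0 : V v0 -> (forall c : K, W (c *: v0) -> c = 0) ->
  (forall v, V v -> exists c : K, W (v - c *: v0)) -> has_dim_mod V W 1.
Proof.
move=> Vv0 indep span; exists (fun=> v0); split=> // [c|v /span[c Wc]].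
  by rewrite big_ord1 => /indep c0 i; rewrite ord1.
by exists (fun=> c); rewrite big_ord1.
Qed.

(** Dimensions add up along a decomposition of [V] into a free part with basis
    [g] and the isomorphic image under [h] of another space. *)
Lemma has_dim_mod_extend (T : eqType) (r : seq T) (g : T -> E)
    (h : E -> E) V V' d :
    (forall c u v, h (c *: u + v) = c *: h u + h v) ->
    uniq r -> (forall x, x \in r -> V (g x)) -> (forall v, V' v -> V (h v)) ->
    injective h ->
    (forall f v, \sum_(x <- r) f x *: g x = h v ->
       forall x, x \in r -> f x = 0) ->
    (forall v, V v -> exists f, exists2 v', V' v' &
       v = \sum_(x <- r) f x *: g x + h v') ->
  has_dim_mod V' [set 0] d -> has_dim_mod V [set 0] (size r + d).
Proof.
move=> h_lin r_uniq Vg Vh h_inj indep span [e [V'e e_indep e_span]].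
have hB u v : h (u - v) = h u - h v.
  by rewrite addrC -scaleN1r h_lin scaleN1r addrC.
have h0 : h 0 = 0 by have := hB 0 0; rewrite !subrr.
have h_sum (c : 'I_d -> K) : h (\sum_j c j *: e j) = \sum_j c j *: h (e j).
  elim: d e {V'e e_indep e_span} c => [|m IHm] e c; first by rewrite !big_ord0.
  by rewrite !big_ord_recl h_lin IHm.
pose e1 i := match split i with
  inl j => g (tnth (in_tuple r) j) | inr j => h (e j) end.
have e1l j : e1 (lshift d j) = g (tnth (in_tuple r) j).
  by rewrite /e1 -[lshift d j]/(unsplit (inl j)) unsplitK.
have e1r j : e1 (rshift (size r) j) = h (e j).
  by rewrite /e1 -[rshift _ j]/(unsplit (inr j)) unsplitK.
have sum_e1 (c : 'I_(size r + d) -> K) f :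
    (forall j, c (lshift d j) = f (tnth (in_tuple r) j)) ->
  \sum_i c i *: e1 i = \sum_(x <- r) f x *: g x
    + h (\sum_j c (rshift (size r) j) *: e j).
  move=> cf; have -> : h (\sum_j c (rshift (size r) j) *: e j) =
      \sum_j c (rshift (size r) j) *: e1 (rshift (size r) j).
    by rewrite h_sum; apply: eq_bigr => j _; rewrite e1r.
  rewrite big_split_ord /= [X in _ = X + _]big_tnth; congr (_ + _).
  by apply: eq_bigr => j _; rewrite e1l cf.
exists e1; split=> [i | c /= c0 i | v /span[f [v' V'v' ->]]].
- rewrite /e1; case: (split i) => j; first by apply: Vg; apply: mem_tnth.
  exact: Vh.
- pose f x := if insub (index x r) is Some j then c (lshift d j) else 0.
  have fE j : c (lshift d j) = f (tnth (in_tuple r) j).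
    have x0 := tnth (in_tuple r) j.
    by rewrite /f (tnth_nth x0) index_uniq // valK.
  have f0 : forall x, x \in r -> f x = 0.
    apply: (indep f (- \sum_j c (rshift (size r) j) *: e j)).
    by apply/eqP; rewrite -sub0r hB h0 sub0r -addr_eq0 -sum_e1 // c0.
  rewrite -(splitK i); case: (split i) => j /=.
    by rewrite fE f0 //; apply: mem_tnth.
  apply: (e_indep (fun j => c (rshift _ j))).
  have g0 : \sum_(x <- r) f x *: g x = 0.
    by rewrite big_seq big1 // => x xr; rewrite f0 ?scale0r.
  by apply: h_inj; rewrite h0; move: c0; rewrite (sum_e1 _ _ fE) g0 add0r.
have [c cE] := e_span v' V'v'.
exists (fun i => match split i with
  inl j => f (tnth (in_tuple r) j) | inr j => c j end).
rewrite (sum_e1 _ f) => [|j]; last first.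
  by rewrite -[lshift d j]/(unsplit (inl j)) unsplitK.
rewrite /= opprD addrACA subrr add0r -hB.
rewrite (eq_bigr (fun j => c j *: e j)) => [|j _]; last first.
  by rewrite -[rshift _ j]/(unsplit (inr j)) unsplitK.
by rewrite cE h0.
Qed.

End Dimensions.

Section HilbertSeries.
Variable K : fieldType.
Hypothesis two_neq0 : 2%:R != 0 :> K.
Local Notation P := {mpoly K[3 + 3]}.
Local Notation disc := (@disc K).
Local Open Scope classical_set_scope.
Implicit Types (p q : P) (a b A B i j k : nat).

Lemma bihomog_disc : bihomog 1 1 disc.
Proof.
have th (i j : 'I_3) : bihomog 1 0 (tvar K i - tvar K j).
  by apply: bihomogB; apply: bihomog_tvar.
have xh (i j : 'I_3) : bihomog 0 1 (xvar K i - xvar K j).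
  by apply: bihomogB; apply: bihomog_xvar.
by apply: bihomogB; apply: (bihomogM (th _ _) (xh _ _)).
Qed.

(** The bidegree of [q] when [disc * q] has bidegree [(A, B)]. *)
Definition lower_bihomog A B : set P :=
  if (A, B) is (A'.+1, B'.+1) then bihomog A' B' else [set 0].

Lemma lower_bihomogP A B q : bihomog A B (disc * q) <-> lower_bihomog A B q.
Proof.
split=> [qAB|]; last first.
  rewrite /lower_bihomog; case: A => [|A]; last case: B => [|B].
  - by move=> ->; rewrite mulr0; apply: bihomog0.
  - by move=> ->; rewrite mulr0; apply: bihomog0.
  by move=> qAB; apply: (bihomogM bihomog_disc qAB).
have := component_bihomog qAB; rewrite (componentM _ _ _ bihomog_disc).
have D0 : disc != 0 := disc_neq0 K.
rewrite /lower_bihomog; case: A B {qAB} => [|A] [|B] /=; rewrite ?subSS ?subn0.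
- by move/esym/eqP; rewrite mulf_eq0 (negPf D0) => /eqP.
- by move/esym/eqP; rewrite mulf_eq0 (negPf D0) => /eqP.
- by move/esym/eqP; rewrite mulf_eq0 (negPf D0) => /eqP.
by move/(mulfI D0) => <-; apply: bihomog_component.
Qed.

(** The direct sum decomposition on which both parts of the theorem rest; it is
    direct by [gen_independent]. *)
Lemma diag_inter_decomp a b A B p : diag_inter a b p -> bihomog A B p ->
  exists f, exists2 q, diag_inter a.-1 b.-1 q /\ lower_bihomog A B q &
    p = \sum_(x <- gen_index (a.*2 + b) A B) f x *: gen K a b A B x + disc * q.
Proof.
move=> pab pAB; have [f [q pE]] := diag_inter_spans two_neq0 pab pAB.
exists f, q => //.
have qE : disc * q =
    p - \sum_(x <- gen_index (a.*2 + b) A B) f x *: gen K a b A B x.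
  by rewrite pE addrC addKr.
split.
  apply/diag_inter_disc; rewrite qE; apply: diag_interB => //.
  by apply: diag_inter_sum => x; apply/diag_interZ/gen_mem.
apply/lower_bihomogP; rewrite qE; apply: bihomogB => //.
by apply: bihomog_sum => x xI; apply/bihomogZ/bihomog_gen.
Qed.


Lemma has_dim_diag_inter a b A B :
  has_dim_mod (diag_inter a b `&` bihomog A B : set P) [set 0]
    (dim_ideal a b A B).
Proof.
have extend A' B' a' b' d :
    has_dim_mod (diag_inter a'.-1 b'.-1 `&` lower_bihomog A' B' : set P)
      [set 0] d ->
  has_dim_mod (diag_inter a' b' `&` bihomog A' B' : set P) [set 0]
    (size (gen_index (a'.*2 + b') A' B') + d).
  apply: (has_dim_mod_extend (g := gen K a' b' A' B') (h := *%R disc)).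
  - by move=> c u v; rewrite mulrDr scalerAr.
  - exact: gen_index_uniq.
  - by move=> x xI; split; [apply: gen_mem | apply: bihomog_gen].
  - by move=> q [qab qAB]; split; [apply/diag_inter_disc | apply/lower_bihomogP].
  - exact: mulfI (disc_neq0 K).
  - by move=> f q; apply: gen_independent.
  by move=> p [pab pAB]; apply: diag_inter_decomp.
have none V : has_dim_mod (V `&` [set 0] : set P) [set 0] 0.
  by apply: has_dim_mod0 => // p [].
elim: A a b B => [|A IHA] a b B /=; rewrite -size_gen_index.
  by rewrite addn0 -[size _]addn0; apply: extend; apply: none.
apply: extend; case: B => [|B]; first exact: none.
exact: IHA.
Qed.

End HilbertSeries.

(** * Minimal generators *)

Section GeneratingSet.
Variable K : fieldType.
Hypothesis two_neq0 : 2%:R != 0 :> K.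
Local Notation P := {mpoly K[3 + 3]}.
Local Notation disc := (@disc K).
Local Notation irrelevant := (@irrelevant_ideal K 3).
Local Open Scope classical_set_scope.
Implicit Types (p q : P) (a b A B i j k : nat).

Definition diag_inter_rad a b : set P :=
  ideal_mul irrelevant (diag_inter a b).
Local Notation mdiag := diag_inter_rad.

Lemma irrelevant_tvar (i : 'I_3) : irrelevant (tvar K i).
Proof. by apply: ideal_gen_mem; left; exists i. Qed.

Lemma irrelevant_xvar (i : 'I_3) : irrelevant (xvar K i).
Proof. by apply: ideal_gen_mem; right; exists i. Qed.

Lemma irrelevantB p q : irrelevant p -> irrelevant q -> irrelevant (p - q).
Proof.
by move=> pm qm; rewrite -mulN1r; apply: ideal_genD pm (ideal_genMl _ qm).
Qed.

Lemma irrelevant_line_form (v : 'I_3 -> P) c :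
  (forall l, irrelevant (v l)) -> irrelevant (line_form v c).
Proof.
move=> vm; rewrite /line_form -!mul_mpolyC.
by apply: ideal_genD; apply: ideal_genMl; repeat apply: irrelevantB.
Qed.

Lemma mdiagMl a b p q : mdiag a b q -> mdiag a b (p * q).
Proof. by move=> qm; apply: ideal_mulMl qm => r; apply: diag_interM. Qed.

Lemma mdiagZ a b (c : K) p : mdiag a b p -> mdiag a b (c *: p).
Proof. by rewrite -mul_mpolyC; apply: mdiagMl. Qed.

Lemma mdiagB a b p q : mdiag a b p -> mdiag a b q -> mdiag a b (p - q).
Proof.
by move=> pm qm; rewrite -mulN1r; apply: ideal_mulD pm (mdiagMl _ qm).
Qed.

Lemma mdiag_disc a b p : mdiag a.-1 b.-1 p -> mdiag a b (disc * p).
Proof.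
elim/ideal_mul_ind: p / => [|p q pm qm|r f rm fab].
- by rewrite mulr0; apply: ideal_mul0.
- by rewrite mulrDr; apply: ideal_mulD.
by rewrite mulrCA; apply: ideal_mul_mem => //; apply/diag_inter_disc.
Qed.

Lemma mdiag_mixed_prod a b k ws :
  (0 < size ws)%N -> mdiag a b (mixed_prod k (ws ++ points K a b)).
Proof.
case: ws => // c ws _; case: k => [|k] /=.
  apply: ideal_mul_mem; last exact: mixed_prod_points_mem.
  by apply: irrelevant_line_form => i; apply: irrelevant_xvar.
apply: ideal_mul_mem; last exact: mixed_prod_points_mem.
by apply: irrelevant_line_form => i; apply: irrelevant_tvar.
Qed.

(** Any degree in excess of [2a + b] is visible as a factor: one of the last
    two variables, or a linear form in front of the word [points]. *)
Lemma mdiag_gen a b A B x : x \in gen_index (a.*2 + b) A B ->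
  (A + B)%N != (a.*2 + b)%N -> mdiag a b (gen K a b A B x).
Proof.
case: x => [[i j] k]; rewrite mem_gen_index => /and3P[leiA lejB ltk] neqAB.
have [ltiA|leAi] := ltnP i A.
  have -> : gen K a b A B (i, j, k) = tvar K o2 * gen K a b A.-1 B (i, j, k).
    rewrite /gen /= !mulrA -exprS; congr (_ ^+ _ * _ * _); lia.
  by apply: ideal_mul_mem; [apply: irrelevant_tvar | apply: gen_mem].
have [ltjB|leBj] := ltnP j B.
  have -> : gen K a b A B (i, j, k) = xvar K o2 * gen K a b A B.-1 (i, j, k).
    rewrite /gen /= mulrA mulrCA -exprS.
    by congr (_ * _ ^+ _ * _); lia.
  by apply: ideal_mul_mem; [apply: irrelevant_xvar | apply: gen_mem].
apply/mdiagMl/mdiag_mixed_prod; rewrite size_cat !size_nseq /=; lia.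
Qed.

Lemma mdiag_sum_gen a b A B f : (A + B)%N != (a.*2 + b)%N ->
  mdiag a b (\sum_(x <- gen_index (a.*2 + b) A B) f x *: gen K a b A B x).
Proof.
move=> neqAB; rewrite big_seq; apply: (big_ind (mdiag a b)).
- exact: ideal_mul0.
- exact: ideal_mulD.
by move=> x xI; apply: mdiagZ; apply: mdiag_gen.
Qed.

(** The expansion of the minor exhibits [disc * q] as a combination of elements
    [(v o1 - v o2) * q] of the ideal with coefficients of degree one. *)
Lemma mdiag_disc0 b q : diag_inter 0 b.-1 q -> mdiag 0 b (disc * q).
Proof.
move=> [qb _ _].
have line (v : 'I_3 -> P) : diag_ideal o1 o2 (v o1 - v o2) ->
    diag_inter 0 b ((v o1 - v o2) * q).
  move=> Iv; split=> //; have := ideal_powM (ideal_pow_mem Iv) qb.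
  by apply: ideal_pow_le; rewrite add1n leqSpred.
rewrite /disc mulrBl [(tvar K o1 - _) * _]mulrC -!mulrA.
apply: mdiagB; apply: ideal_mul_mem.
- by apply: irrelevantB; apply: irrelevant_xvar.
- by apply: line; apply: ideal_gen_mem; left.
- by apply: irrelevantB; apply: irrelevant_tvar.
by apply: line; apply: ideal_gen_mem; right.
Qed.

(** Decompose [q] itself.  Its degree is still above the generating degree
    [2(a-1) + (b-1)] of the smaller ideal, because lowering [a] and [b] by one
    lowers that degree by 3 while [disc] accounts for only 2.  This fails
    for [b = 0 < a], hence the hypothesis [a <= b]. *)
Lemma mdiag_disc_high a b A B q : (a <= b)%N -> (a.*2 + b <= A + B)%N ->
  diag_inter a.-1 b.-1 q -> lower_bihomog A B q -> mdiag a b (disc * q).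
Proof.
elim: a b A B q => [|a IHa] b A B q leab leAB qab qAB.
  exact: mdiag_disc0.
case: b leab leAB qab => // b leab leAB qab.
apply: mdiag_disc => /=; move: qAB leAB; rewrite /lower_bihomog.
case: A => [|A]; last case: B => [|B]; try by move=> -> _; apply: ideal_mul0.
move=> qAB leAB; have [f [r [rab rAB] ->]] := diag_inter_decomp two_neq0 qab qAB.
apply: ideal_mulD; first by apply: mdiag_sum_gen; lia.
by apply: (IHa b A B) => //; lia.
Qed.

Lemma mdiag_high a b A B p : (a <= b)%N -> (a.*2 + b < A + B)%N ->
  diag_inter a b p -> bihomog A B p -> mdiag a b p.
Proof.
move=> leab ltAB pab pAB.
have [f [q [qab qAB] ->]] := diag_inter_decomp two_neq0 pab pAB.
apply: ideal_mulD; first by apply: mdiag_sum_gen; rewrite gtn_eqF.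
by apply: mdiag_disc_high qab qAB => //; apply: ltnW.
Qed.

Lemma diag_inter_low a b A B p : (A + B < a.*2 + b)%N ->
  diag_inter a b p -> bihomog A B p ->
  exists q, [/\ diag_inter a.-1 b.-1 q, lower_bihomog A B q & p = disc * q].
Proof.
move=> ltAB pab pAB.
have [f [q [qab qAB] pE]] := diag_inter_decomp two_neq0 pab pAB.
exists q; split=> //; rewrite pE big_seq big1 ?add0r // => -[[i j] k].
by rewrite mem_gen_index => /and3P[? ? ?]; exfalso; lia.
Qed.

(** Write [p] as a sum of variables times elements of the ideal.  After passing
    to components, these elements have degree below [2a + b], hence are
    multiples of [disc] by [diag_inter_low]. *)
Lemma mdiag_low a b A B p : (A + B <= a.*2 + b)%N ->
  mdiag a b p -> bihomog A B p ->
  exists2 q, mdiag a.-1 b.-1 q & p = disc * q.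
Proof.
move=> leAB pm /component_bihomog <-.
have low0 : exists2 q, mdiag a.-1 b.-1 q & 0 = disc * q.
  by exists 0; [apply: ideal_mul0 | rewrite mulr0].
have lowD x y : (exists2 q, mdiag a.-1 b.-1 q & x = disc * q) ->
    (exists2 q, mdiag a.-1 b.-1 q & y = disc * q) ->
  exists2 q, mdiag a.-1 b.-1 q & x + y = disc * q.
  move=> [q qm ->] [r rm ->]; exists (q + r); last by rewrite mulrDr.
  exact: ideal_mulD.
have low_comp C D f : (C + D < a.*2 + b)%N -> diag_inter a b f ->
    exists2 q, diag_inter a.-1 b.-1 q & component C D f = disc * q.
  move=> ltCD fab; have [q [qab _ fE]] :=
    diag_inter_low ltCD (component_diag_inter C D fab) (@bihomog_component K 3 C D f).
  by exists q.
elim/ideal_mul_ind: p / pm => [|x y|r f].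
- by rewrite /component rmorph0 !coef0.
- by rewrite componentD; apply: lowD.
elim/ideal_mul_ind => [|x y IHx IHy|x v _ vm] fab.
- by rewrite mul0r /component rmorph0 !coef0.
- by rewrite mulrDl componentD; apply: lowD; [apply: IHx | apply: IHy].
rewrite -mulrA mulrCA; have {}fab := diag_interM x fab.
case: vm => -[i _ <-].
  rewrite (componentM _ _ _ (@bihomog_tvar K 3 i)); case: ifP => // /andP[lt0A _].
  have [|q qab ->] := low_comp (A - 1)%N (B - 0)%N _ _ fab; first by lia.
  exists (tvar K i * q); last by rewrite mulrCA.
  by apply: ideal_mul_mem => //; apply: irrelevant_tvar.
rewrite (componentM _ _ _ (@bihomog_xvar K 3 i)); case: ifP => // /andP[_ lt0B].
have [|q qab ->] := low_comp (A - 0)%N (B - 1)%N _ _ fab; first by lia.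
exists (xvar K i * q); last by rewrite mulrCA.
by apply: ideal_mul_mem => //; apply: irrelevant_xvar.
Qed.

(** In the degree [2a + b] of the top layer there is a single generator: its
    index is [(A, B, 0)]. *)
Lemma has_dim_generators_top a b A B : (a <= b)%N -> (A + B)%N = (a.*2 + b)%N ->
  has_dim_mod (diag_inter a b `&` bihomog A B : set P) (mdiag a b) 1.
Proof.
move=> leab AB; pose x0 := (A, B, 0%N).
have idx0 x : (x \in gen_index (a.*2 + b) A B) = (x == x0).
  case: x => [[i j] k]; rewrite mem_gen_index !xpair_eqE; lia.
have x0I : x0 \in gen_index (a.*2 + b) A B by rewrite idx0.
have sum_x0 (f : nat * nat * nat -> K) :
    \sum_(x <- gen_index (a.*2 + b) A B) f x *: gen K a b A B x =
    f x0 *: gen K a b A B x0.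
  rewrite (bigD1_seq x0) ?gen_index_uniq //= big_seq_cond big1 ?addr0 //.
  by move=> x; rewrite idx0 => /andP[->].
apply: (has_dim_mod1 (v0 := gen K a b A B x0)) => [|c cm|p [pab pAB]].
- by split; [apply: gen_mem | apply: bihomog_gen].
- have cAB := bihomogZ (c := c) (@bihomog_gen K _ _ _ _ _ x0I).
  have [|q _ cE] := mdiag_low _ cm cAB; first by rewrite AB.
  (* An element [disc * q] of the span of the generators has zero coefficients. *)
  apply: (@gen_independent K a b A B (fun=> c) q _ x0 x0I).
  by rewrite (sum_x0 (fun=> c)).
have [f [q [qab qAB] ->]] := diag_inter_decomp two_neq0 pab pAB.
exists (f x0); rewrite sum_x0 addrAC subrr add0r.
by apply: mdiag_disc_high qab qAB => //; rewrite AB.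
Qed.

(** Above degree [2a + b] everything is in [m J].  Below it, for [a > 0], the ideal and
    [m J] are [disc] times the corresponding spaces for [(a-1, b-1)]; for [a = 0]
    all elements are in [m J]. *)
Lemma has_dim_generators a b A B : (a <= b)%N ->
  has_dim_mod (diag_inter a b `&` bihomog A B : set P) (mdiag a b)
    (dim_generators a b A B).
Proof.
elim: a b A B => [|a IHa] b A B leab /=.
  case: eqP => [AB|/eqP neqAB]; first exact: has_dim_generators_top.
  apply: has_dim_mod0 => [|p [pab pAB]]; first exact: ideal_mul0.
  have [f [q [qab _] ->]] := diag_inter_decomp two_neq0 pab pAB.
  by apply: ideal_mulD; [apply: mdiag_sum_gen | apply: mdiag_disc0].
case: eqP => [AB|/eqP neqAB]; first exact: has_dim_generators_top.
have [leAB|ltAB] := leqP (A + B) (a.+1.*2 + b); last first.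
  rewrite (_ : (match A with 0 => _ | _ => _ end) = 0%N).
    apply: has_dim_mod0 => [|p [pab pAB]]; first exact: ideal_mul0.
    exact: mdiag_high pab pAB.
  have := dim_generators_above leab ltAB; rewrite /= (negPf neqAB).
  by [].
have {leAB} ltAB : (A + B < a.+1.*2 + b)%N by rewrite ltn_neqAle neqAB.
have zero C : (C = 0)%N -> lower_bihomog A B = [set 0 : P] ->
    has_dim_mod (diag_inter a.+1 b `&` bihomog A B : set P) (mdiag a.+1 b) C.
  move=> -> lowE; apply: has_dim_mod0 => [|p [pab pAB]]; first exact: ideal_mul0.
  have [q [_ + ->]] := diag_inter_low ltAB pab pAB.
  by rewrite lowE => ->; rewrite mulr0; apply: ideal_mul0.
case: A {neqAB} ltAB zero => [|A] ltAB zero; first exact: zero.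
case: B ltAB zero => [|B] ltAB zero; first exact: zero.
have leab' : (a <= b.-1)%N by case: b leab {ltAB zero}.
have [e [eV e_indep e_span]] := IHa b.-1 A B leab'.
have discZ m (c : 'I_m -> K) (g : 'I_m -> P) :
    \sum_i c i *: (disc * g i) = disc * \sum_i c i *: g i.
  by rewrite mulr_sumr; apply: eq_bigr => i _; rewrite scalerAr.
exists (fun l => disc * e l); split=> [l | c cm | p [pab pAB]].
- have [eab eAB] := eV l; split; first by apply/diag_inter_disc.
  by apply/lower_bihomogP.
- apply: e_indep; rewrite discZ in cm.
  have cAB : bihomog A.+1 B.+1 (disc * \sum_i c i *: e i).
    apply/lower_bihomogP; rewrite /lower_bihomog; apply: bihomog_sum => l _.
    by apply: bihomogZ; have [] := eV l.
  have [q qm /(mulfI (disc_neq0 K)) -> //] := mdiag_low (ltnW ltAB) cm cAB.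
have [q [qab qAB ->]] := diag_inter_low ltAB pab pAB.
have [c cm] := e_span q (conj qab qAB); exists c.
by rewrite discZ -mulrBr; apply: mdiag_disc.
Qed.

End GeneratingSet.

(** * Power series expansions of rational functions *)

Section Expansions.
Local Notation poly2 := {poly {poly rat}}.
Implicit Types (p q r N D : poly2) (h g : nat -> nat -> nat).

Definition truncation M h : poly2 := \poly_(i < M) \poly_(j < M) (h i j)%:R.

Lemma coef_truncation M h i j : (i < M)%N -> (j < M)%N ->
  (truncation M h)`_i`_j = (h i j)%:R.
Proof. by move=> ltiM ltjM; rewrite coef_poly ltiM coef_poly ltjM. Qed.

(** Power series identities are checked on truncations, modulo all terms of
    degree at least [M] in one of the variables: polynomial multiplication is
    then available instead of convolutions of coefficients. *)
Definition congr_below M p q :=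
  forall i j, (i < M)%N -> (j < M)%N -> p`_i`_j = q`_i`_j.

Lemma coefM2 p q i j : (p * q)`_i`_j =
  \sum_(k < i.+1) \sum_(l < j.+1) p`_k`_l * q`_(i - k)`_(j - l).
Proof. by rewrite coefM coef_sum; apply: eq_bigr => k _; rewrite coefM. Qed.

Lemma congr_belowMl M r p q :
  congr_below M p q -> congr_below M (r * p) (r * q).
Proof.
move=> pq i j ltiM ltjM; rewrite !coefM2; apply: eq_bigr => k _.
by apply: eq_bigr => l _; rewrite pq //; apply: leq_ltn_trans (leq_subr _ _) _.
Qed.

Lemma congr_below_trans M p q r :
  congr_below M p q -> congr_below M q r -> congr_below M p r.
Proof. by move=> pq qr i j ltiM ltjM; rewrite pq // qr. Qed.

Lemma congr_belowD M p p' q q' : congr_below M p p' -> congr_below M q q' ->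
  congr_below M (p + q) (p' + q').
Proof. by move=> pp qq i j ltiM ltjM; rewrite !coefD pp // qq. Qed.

Lemma is_expansionP f h : is_expansion f h <-> exists N D,
  [/\ D`_0`_0 != 0, f = tofrac N / tofrac D
    & forall M, congr_below M (D * truncation M h) N].
Proof.
have coefE D M i j : (i < M)%N -> (j < M)%N -> (D * truncation M h)`_i`_j =
    \sum_(k < i.+1) \sum_(l < j.+1) D`_k`_l * (h (i - k) (j - l))%N%:R.
  move=> ltiM ltjM; rewrite coefM2; apply: eq_bigr => k _.
  apply: eq_bigr => l _; rewrite coef_truncation //;
    exact: leq_ltn_trans (leq_subr _ _) _.
split=> -[N [D [D0 fE hE]]]; exists N, D; split=> //.
  by move=> M i j ltiM ltjM; rewrite coefE.
move=> i j; rewrite -(coefE _ (maxn i j).+1) ?ltnS ?leq_maxl ?leq_maxr //.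
by rewrite hE ?ltnS ?leq_maxl ?leq_maxr.
Qed.

Lemma coef00_neq0 D : D`_0`_0 != 0 -> tofrac D != 0 :> {fraction poly2}.
Proof.
by move=> D0; rewrite tofrac_eq0; apply: contraNneq D0 => ->; rewrite !coef0.
Qed.

Lemma coef00M p q : (p * q)`_0`_0 = p`_0`_0 * q`_0`_0.
Proof. by rewrite coefM2 !big_ord1. Qed.

Lemma eq_is_expansion f h g : h =2 g -> is_expansion f h -> is_expansion f g.
Proof.
move=> hg [N [D [D0 fE hE]]]; exists N, D; split=> // a b; rewrite -hE.
by apply: eq_bigr => i _; apply: eq_bigr => j _; rewrite hg.
Qed.

Lemma is_expansion1 : is_expansion 1 (fun i j => (i == 0%N) && (j == 0%N)).
Proof.
apply/is_expansionP; exists 1, 1; rewrite !coef1 oner_neq0 rmorph1 divr1.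
split=> // M i j ltiM ltjM; rewrite mul1r coef_truncation // coef1.
by case: (i == _); rewrite /= ?coef0 ?coef1.
Qed.

Lemma is_expansionD f1 f2 h1 h2 : is_expansion f1 h1 -> is_expansion f2 h2 ->
  is_expansion (f1 + f2) (fun i j => h1 i j + h2 i j)%N.
Proof.
move=> /is_expansionP[N1 [D1 [D10 -> h1E]]] /is_expansionP[N2 [D2 [D20 -> h2E]]].
apply/is_expansionP; exists (D2 * N1 + D1 * N2), (D1 * D2).
rewrite coef00M mulf_neq0 //; split=> //.
  rewrite addf_div ?coef00_neq0 // rmorphD !rmorphM.
  by rewrite [tofrac D2 * _]mulrC [tofrac D1 * tofrac N2]mulrC.
move=> M; have -> : truncation M (fun i j => h1 i j + h2 i j)%N =
    truncation M h1 + truncation M h2.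
  apply/polyP => i; apply/polyP => j; rewrite !(coefD, coef_poly).
  case: ifP => _; rewrite ?coef0 ?addr0 // !coef_poly.
  by case: ifP; rewrite ?addr0 // natrD.
rewrite mulrDr; apply: congr_belowD.
  by rewrite [D1 * _]mulrC -mulrA; apply: congr_belowMl.
by rewrite -mulrA; apply: congr_belowMl.
Qed.

Lemma is_expansionMpoly (P : poly2) f h g :
    (forall M, congr_below M (truncation M g) (P * truncation M h)) ->
  is_expansion f h -> is_expansion (tofrac P * f) g.
Proof.
move=> gE /is_expansionP[N [D [D0 -> hE]]]; apply/is_expansionP.
exists (P * N), D; split=> //; first by rewrite rmorphM mulrA.
move=> M; apply: congr_below_trans (congr_belowMl _ (gE M)) _.
by rewrite mulrCA; apply: congr_belowMl.
Qed.

Lemma is_expansion_divpoly (P : poly2) f h g : P`_0`_0 != 0 ->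
    (forall M, congr_below M (P * truncation M g) (truncation M h)) ->
  is_expansion f h -> is_expansion (f / tofrac P) g.
Proof.
move=> P0 gE /is_expansionP[N [D [D0 -> hE]]]; apply/is_expansionP.
exists N, (D * P); rewrite coef00M mulf_neq0 //; split=> //.
  by rewrite rmorphM invfM mulrA.
move=> M; rewrite -mulrA; apply: congr_below_trans (hE M).
exact: congr_belowMl.
Qed.

Lemma is_expansion_qvM f h : is_expansion f h ->
  is_expansion (qv * f) (fun i j => if i is i'.+1 then h i' j else 0%N).
Proof.
apply: is_expansionMpoly => M [|i] j ltiM ltjM.
  by rewrite coef_truncation // coefXM coef0.
by rewrite coefXM /= !coef_truncation // ltnW.
Qed.

Lemma is_expansion_tvM f h : is_expansion f h ->
  is_expansion (tv * f) (fun i j => if j is j'.+1 then h i j' else 0%N).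
Proof.
apply: is_expansionMpoly => M i [|j] ltiM ltjM.
  by rewrite coef_truncation // coefCM coefXM.
by rewrite coefCM coefXM /= !coef_truncation // ltnW.
Qed.

Lemma is_expansion_div1q f h : is_expansion f h ->
  is_expansion (f / (1 - qv)) (fun i j => \sum_(k < i.+1) h k j)%N.
Proof.
rewrite (_ : 1 - qv = tofrac (1 - 'X)); last by rewrite rmorphB rmorph1.
apply: is_expansion_divpoly; first by rewrite coefB coef1 coefX subr0 coef1.
move=> M [|i] j ltiM ltjM; rewrite mulrBl mul1r !coefB coefXM /=.
  by rewrite coef0 subr0 !coef_truncation // big_ord1.
by rewrite !coef_truncation //= 1?ltnW // big_ord_recr /= natrD addrAC subrr add0r.
Qed.

Lemma is_expansion_div1t f h : is_expansion f h ->
  is_expansion (f / (1 - tv)) (fun i j => \sum_(k < j.+1) h i k)%N.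
Proof.
rewrite (_ : 1 - tv = tofrac (1 - 'X%:P)); last by rewrite rmorphB rmorph1.
apply: is_expansion_divpoly.
  by rewrite coefB coef1 coefC coefB coef1 coefX subr0.
move=> M i [|j] ltiM ltjM; rewrite mulrBl mul1r !coefB coefCM coefXM /=.
  by rewrite subr0 !coef_truncation // big_ord1.
by rewrite !coef_truncation //= 1?ltnW // big_ord_recr /= natrD addrAC subrr add0r.
Qed.

(** A recursion along the diagonal is division by [1 - q t]. *)
Lemma is_expansion_div1qt f g h : is_expansion f g ->
    (forall i j, h i j = g i j +
      if (i, j) is (i'.+1, j'.+1) then h i' j' else 0)%N ->
  is_expansion (f / (1 - qv * tv)) h.
Proof.
move=> fg hE; move: fg.
rewrite (_ : 1 - qv * tv = tofrac (1 - 'X * 'X%:P)); last first.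
  by rewrite rmorphB rmorphM rmorph1.
apply: is_expansion_divpoly.
  by rewrite coefB coef1 coefMC coefX mul0r subr0 coef1.
move=> M i j ltiM ltjM.
rewrite mulrBl mul1r !coefB -mulrA coefXM coefCM.
case: i ltiM => [|i] ltiM; first by rewrite coef0 subr0 !coef_truncation // hE addn0.
rewrite /= coefXM; case: j ltjM => [|j] ltjM.
  by rewrite /= subr0 !coef_truncation // hE addn0.
by rewrite /= !coef_truncation //= 1?ltnW // hE natrD addrK.
Qed.

End Expansions.

Section ClosedForms.
Variable F : fieldType.
Implicit Types q t : F.

(** The complete homogeneous symmetric polynomial of degree [e]. *)
Definition hsym q t e := (q ^+ e.+1 - t ^+ e.+1) / (q - t).

(** The sum over [m >= e] of [(m - e + 1)] times the complete homogeneous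
    symmetric polynomial of degree [m]; see [is_expansion_hsym_sum]. *)
Definition hsym_sum q t e :=
  (q ^+ e.+1 / (1 - q) ^+ 2 - t ^+ e.+1 / (1 - t) ^+ 2) / (q - t).

Lemma hsym0 q t : q - t != 0 -> hsym q t 0 = 1.
Proof. by move=> qt; rewrite /hsym !expr1 divff. Qed.

Lemma hsymS q t e : q - t != 0 ->
  hsym q t e.+1 = q * hsym q t e + t ^+ e.+1.
Proof. by move=> qt; rewrite /hsym !exprS; field. Qed.

Lemma hsym_sum0 q t : q - t != 0 -> 1 - q != 0 -> 1 - t != 0 ->
  hsym_sum q t 0 =
    1 / (1 - q) / (1 - t) / (1 - q) + t * (1 / (1 - q) / (1 - t) / (1 - t)).
Proof. by move=> qt q1 t1; rewrite /hsym_sum; field; rewrite qt q1 t1. Qed.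

Lemma hsym_sumS q t e : q - t != 0 -> 1 - q != 0 -> 1 - t != 0 ->
  hsym_sum q t e.+1 =
    q * hsym_sum q t e + t ^+ e.+1 * (1 / (1 - t) / (1 - t)).
Proof.
by move=> qt q1 t1; rewrite /hsym_sum !exprS; field; rewrite qt q1 t1.
Qed.

End ClosedForms.

Section Denominators.

(** This decides which factors of the products are of the form [1 - 1] and have
    to be omitted. *)
Lemma qv_exp_tv_exp_inj a b c d :
  qv ^+ a * tv ^+ b = qv ^+ c * tv ^+ d -> a = c /\ b = d.
Proof.
have coefqt m n i j : ('X^m * ('X%:P) ^+ n : {poly {poly rat}})`_i`_j =
    ((i == m) && (j == n))%:R.
  rewrite -rmorphXn coefMC coefXn; case: (i == m); last by rewrite mul0r coef0.
  by rewrite mul1r coefXn.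
move=> qtE; have E : 'X^a * ('X%:P) ^+ b = 'X^c * ('X%:P) ^+ d :> {poly {poly rat}}.
  by apply/eqP; rewrite -tofrac_eq !rmorphM !(rmorphXn (@tofrac _)); apply/eqP.
have := coefqt c d c d; rewrite -E coefqt !eqxx.
by case: eqP => [->|_]; case: eqP => [->|_] //= /eqP; rewrite eq_sym oner_eq0.
Qed.

Lemma sub_monomials_neq0 a b c d : (a != c) || (b != d) ->
  qv ^+ a * tv ^+ b - qv ^+ c * tv ^+ d != 0.
Proof.
move=> abcd; rewrite subr_eq0; apply/eqP => /qv_exp_tv_exp_inj[ac bd].
by rewrite ac bd !eqxx in abcd.
Qed.

Lemma sub_qt_neq0 : qv - tv != 0.
Proof.
by have := @sub_monomials_neq0 1 0 0 1 isT; rewrite !expr0 !expr1 mulr1 mul1r.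
Qed.

Lemma sub_1q_neq0 : 1 - qv != 0.
Proof.
by have := @sub_monomials_neq0 0 0 1 0 isT; rewrite !expr0 !expr1 !mulr1.
Qed.

Lemma sub_1t_neq0 : 1 - tv != 0.
Proof.
by have := @sub_monomials_neq0 0 0 0 1 isT; rewrite !expr0 !expr1 !mul1r.
Qed.

End Denominators.

Section SymmetricExpansions.

Lemma is_expansion_tvXM n f h : is_expansion f h ->
  is_expansion (tv ^+ n * f)
    (fun i j => if (n <= j)%N then h i (j - n)%N else 0%N).
Proof.
move=> fh; elim: n => [|n IHn].
  by rewrite mul1r; apply: eq_is_expansion fh => i j; rewrite subn0.
rewrite exprS -mulrA; apply: eq_is_expansion (is_expansion_tvM IHn).
by move=> i [|j]; rewrite // subSS.
Qed.

Lemma is_expansion_hsym e :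
  is_expansion (hsym qv tv e) (fun i j => (i + j)%N == e).
Proof.
elim: e => [|e IHe].
  rewrite (hsym0 sub_qt_neq0); apply: eq_is_expansion is_expansion1 => i j.
  by rewrite addn_eq0.
rewrite (hsymS _ sub_qt_neq0).
have := is_expansionD (is_expansion_qvM IHe)
                      (is_expansion_tvXM e.+1 is_expansion1).
rewrite mulr1; apply: eq_is_expansion => -[|i] j; last first.
  by rewrite addSn eqSS /= if_same addn0.
by rewrite /=; case: leqP => ej; lia.
Qed.

Lemma is_expansion_geometric :
  is_expansion (1 / (1 - qv) / (1 - tv)) (fun i j => 1%N).
Proof.
apply: eq_is_expansion (is_expansion_div1t (is_expansion_div1q is_expansion1)).
move=> i j; rewrite big_ord_recl [X in (_ + X)%N]big1 => [|l _]; last first.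
  by rewrite big1 // => k _; rewrite andbF.
by rewrite addn0 big_ord_recl big1.
Qed.

(** Both sides satisfy [s_(e+1) = q s_e + t^(e+1) / (1-t)^2], which separates
    the coefficients with [i > 0] from those with [i = 0]. *)
Lemma is_expansion_hsym_sum e :
  is_expansion (hsym_sum qv tv e) (fun i j => (i + j).+1 - e)%N.
Proof.
elim: e => [|e IHe].
  rewrite (hsym_sum0 sub_qt_neq0 sub_1q_neq0 sub_1t_neq0).
  have := is_expansionD (is_expansion_div1q is_expansion_geometric)
    (is_expansion_tvM (is_expansion_div1t is_expansion_geometric)).
  apply: eq_is_expansion => i [|j]; rewrite !sum_nat_const !card_ord; lia.
rewrite (hsym_sumS _ sub_qt_neq0 sub_1q_neq0 sub_1t_neq0).
have := is_expansionD (is_expansion_qvM IHe) (is_expansion_tvXM e.+1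
  (is_expansion_div1t (is_expansion_div1t is_expansion1))).
apply: eq_is_expansion => -[|i] j.
  rewrite (eq_bigr (fun=> 1%N)) => [|l _].
    by rewrite sum_nat_const card_ord; case: leqP; lia.
  by rewrite big_ord_recl big1.
rewrite big1 => [|l _]; last by rewrite big1.
by rewrite if_same; lia.
Qed.

End SymmetricExpansions.

(** * Closed forms of the sums over four tableaux *)

Section TableauSums.
Variables (F : fieldType) (q t : F).
Hypothesis qt_indep : forall a b c d,
  q ^+ a * t ^+ b = q ^+ c * t ^+ d -> a = c /\ b = d.

(** The factors are studied in an abstract field with two elements [q] and [t]
    having distinct monomials, where computations are not slowed down by the
    construction of the field of fractions. *)
Definition omit1 (x : F) := if x == 1 then 1 else 1 - x.

Definition kernel_omega x :=
  (omit1 x * omit1 (q * t * x)) / (omit1 (q * x) * omit1 (t * x)).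

Definition kernel_omegas x0 x1 x2 :=
  kernel_omega (x0 / x1) * kernel_omega (x0 / x2) * kernel_omega (x1 / x2).

Definition weightH d1 d2 d3 x0 x1 x2 :=
  (x0 ^+ d3 * x1 ^+ d2 * x2 ^+ d1) / ((1 - q) ^+ 3 * (1 - t) ^+ 3)
  * ((omit1 x1^-1)^-1 * (omit1 x2^-1)^-1) * kernel_omegas x0 x1 x2.

Definition weightF d1 d2 d3 x0 x1 x2 :=
  (x0 ^+ d3 * x1 ^+ d2 * x2 ^+ d1)
  * ((omit1 x1^-1 * omit1 (q * t * x0 / x1))^-1
     * (omit1 x2^-1 * omit1 (q * t * x1 / x2))^-1) * kernel_omegas x0 x1 x2.

(** The arguments are the contents of the boxes 1, 2, 3 of the row, the two
    hooks and the column. *)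
Definition sum4 (w : F -> F -> F -> F) :=
  w 1 q (q ^+ 2) + w 1 q t + w 1 t q + w 1 t (t ^+ 2).

Local Notation mon a b := (q ^+ a * t ^+ b).

Let q_neq0 : q != 0.
Proof.
apply/eqP => q0; have [] // := @qt_indep 1 0 2 0.
by rewrite q0 !expr0n !mul0r.
Qed.

Let t_neq0 : t != 0.
Proof.
apply/eqP => t0; have [] // := @qt_indep 0 1 0 2.
by rewrite t0 !expr0n !mulr0.
Qed.

Let mon_neq0 a b : mon a b != 0.
Proof. by rewrite mulf_neq0 ?expf_neq0. Qed.

Let sub_mon a b c d : (a != c) || (b != d) -> mon a b - mon c d != 0.
Proof.
move=> abcd; rewrite subr_eq0; apply/eqP => /qt_indep[ac bd].
by rewrite ac bd !eqxx in abcd.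
Qed.

(** With every argument a quotient of monomials, omission of a factor is
    decided by comparing exponents. *)
Let omit1_mon a b c d : omit1 (mon a b / mon c d) =
  if (a == c) && (b == d) then 1 else (mon c d - mon a b) / mon c d.
Proof.
rewrite /omit1 (_ : (mon a b / mon c d == 1) = (a == c) && (b == d)).
  by case: ifP => // _; rewrite mulrBl divff.
rewrite -[1](divff (mon_neq0 c d)) (inj_eq (mulIf _)) ?invr_neq0 //.
by apply/eqP/andP => [/qt_indep[-> ->] // | [/eqP-> /eqP->]].
Qed.

Let kernel_omega_mon a b c d : kernel_omega (mon a b / mon c d) =
  (omit1 (mon a b / mon c d) * omit1 (mon a.+1 b.+1 / mon c d))
  / (omit1 (mon a.+1 b / mon c d) * omit1 (mon a b.+1 / mon c d)).
Proof.
rewrite /kernel_omega; congr (_ * omit1 _ / (omit1 _ * omit1 _));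
  rewrite !exprS; ring.
Qed.

Let weightH_mon d1 d2 d3 a b c d : weightH d1 d2 d3 1 (mon a b) (mon c d) =
  (mon a b ^+ d2 * mon c d ^+ d1) / ((1 - q) ^+ 3 * (1 - t) ^+ 3)
  * ((omit1 (mon 0 0 / mon a b))^-1 * (omit1 (mon 0 0 / mon c d))^-1)
  * (kernel_omega (mon 0 0 / mon a b) * kernel_omega (mon 0 0 / mon c d)
     * kernel_omega (mon a b / mon c d)).
Proof. by rewrite /weightH /kernel_omegas !expr0 expr1n !(mul1r, mulr1). Qed.

Let weightF_mon d1 d2 d3 a b c d : weightF d1 d2 d3 1 (mon a b) (mon c d) =
  (mon a b ^+ d2 * mon c d ^+ d1)
  * ((omit1 (mon 0 0 / mon a b) * omit1 (mon 1 1 / mon a b))^-1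
     * (omit1 (mon 0 0 / mon c d) * omit1 (mon a.+1 b.+1 / mon c d))^-1)
  * (kernel_omega (mon 0 0 / mon a b) * kernel_omega (mon 0 0 / mon c d)
     * kernel_omega (mon a b / mon c d)).
Proof.
rewrite /weightF /kernel_omegas !expr0 expr1n !(mul1r, mulr1) !expr1.
by rewrite !exprS [q * t * (_ * _)]mulrACA.
Qed.

Let sum4E (w : F -> F -> F -> F) : sum4 w =
  w 1 (mon 1 0) (mon 2 0) + w 1 (mon 1 0) (mon 0 1)
  + w 1 (mon 0 1) (mon 1 0) + w 1 (mon 0 1) (mon 0 2).
Proof. by rewrite !expr0 !expr1 !(mul1r, mulr1). Qed.

(** The exponent of the first content is set to 0, as that content is 1. *)
Definition hilb4 a b := sum4 (weightH a b 0).
Definition catalan4 a b := sum4 (weightF a b 0).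

Let expand4 := (weightH_mon, weightF_mon, kernel_omega_mon, omit1_mon).

Ltac bidegree_of m :=
  lazymatch m with
  | 1 => constr:((0, 0)%N)
  | q => constr:((1, 0)%N)
  | t => constr:((0, 1)%N)
  | q ^+ ?k => constr:((k, 0)%N)
  | t ^+ ?k => constr:((0, k)%N)
  | ?m1 * ?m2 =>
    let d1 := bidegree_of m1 in let d2 := bidegree_of m2 in
    eval compute in (d1.1 + d2.1, d1.2 + d2.2)%N
  end.

(* The side conditions of the [field] tactic below are differences of two
   monomials; reading off the exponents reduces them to [sub_mon]. *)
Ltac monomials_differ :=
  repeat (apply/andP; split);
  lazymatch goal with
  | |- is_true (?x - ?y != 0) =>
    let d := bidegree_of x in let e := bidegree_of y in
    let d1 := eval compute in d.1 in let d2 := eval compute in d.2 in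
    let e1 := eval compute in e.1 in let e2 := eval compute in e.2 in
    by have := @sub_mon d1 d2 e1 e2 isT;
       rewrite ?expr0 ?expr1 ?mulr1 ?mul1r
  | _ => first [exact: q_neq0 | exact: t_neq0]
  end.

Lemma weightH_row a b : weightH a b 0 1 (mon 1 0) (mon 2 0) =
  q ^+ b * (q ^+ 2) ^+ a * q ^+ 3
  / ((1 - q) ^+ 3 * (1 - t) * (q - t) * (q ^+ 2 - t)).
Proof.
rewrite !expand4 /= !expr0 !expr1 !mulr1; field; monomials_differ.
Qed.

Lemma weightH_column a b : weightH a b 0 1 (mon 0 1) (mon 0 2) =
  t ^+ b * (t ^+ 2) ^+ a * t ^+ 3
  / ((1 - t) ^+ 3 * (1 - q) * (t - q) * (t ^+ 2 - q)).
Proof.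
rewrite !expand4 /= !expr0 !expr1 !mul1r; field; monomials_differ.
Qed.

Lemma weightH_hook a b : weightH a b 0 1 (mon 1 0) (mon 0 1) =
  q ^+ b * t ^+ a * (q * t * (1 + q))
  / ((1 - q) ^+ 2 * (1 - t) ^+ 2 * (q - t) * (t - q ^+ 2)).
Proof.
rewrite !expand4 /= !expr0 !expr1 !mulr1 !mul1r; field; monomials_differ.
Qed.

Lemma weightH_hook' a b : weightH a b 0 1 (mon 0 1) (mon 1 0) =
  t ^+ b * q ^+ a * (q * t * (1 + t))
  / ((1 - q) ^+ 2 * (1 - t) ^+ 2 * (t - q) * (q - t ^+ 2)).
Proof.
rewrite !expand4 /= !expr0 !expr1 !mulr1 !mul1r; field; monomials_differ.
Qed.

Lemma weightF_row a b : weightF a b 0 1 (mon 1 0) (mon 2 0) =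
  q ^+ b * (q ^+ 2) ^+ a * q ^+ 3 / ((q - t) * (q ^+ 2 - t)).
Proof.
rewrite !expand4 /= !expr0 !expr1 !mulr1; field; monomials_differ.
Qed.

Lemma weightF_column a b : weightF a b 0 1 (mon 0 1) (mon 0 2) =
  t ^+ b * (t ^+ 2) ^+ a * t ^+ 3 / ((t - q) * (t ^+ 2 - q)).
Proof.
rewrite !expand4 /= !expr0 !expr1 !mul1r; field; monomials_differ.
Qed.

Lemma weightF_hook a b : weightF a b 0 1 (mon 1 0) (mon 0 1) =
  q ^+ b * t ^+ a * (q * t) / ((q - t) * (t - q ^+ 2)).
Proof.
rewrite !expand4 /= !expr0 !expr1 !mulr1 !mul1r; field; monomials_differ.
Qed.

Lemma weightF_hook' a b : weightF a b 0 1 (mon 0 1) (mon 1 0) =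
  t ^+ b * q ^+ a * (q * t) / ((t - q) * (q - t ^+ 2)).
Proof.
rewrite !expand4 /= !expr0 !expr1 !mulr1 !mul1r; field; monomials_differ.
Qed.

Let weightHE := (weightH_row, weightH_column, weightH_hook, weightH_hook').
Let weightFE := (weightF_row, weightF_column, weightF_hook, weightF_hook').

Lemma hilb4_00 : hilb4 0 0 =
  hsym_sum q t 0 / (1 - q) / (1 - t) / (1 - q * t).
Proof.
rewrite /hilb4 sum4E !weightHE /hsym_sum !expr1; field; monomials_differ.
Qed.

Lemma hilb4_0S b : hilb4 0 b.+1 =
  hsym_sum q t b.+1 / (1 - q) / (1 - t) + q * t * hilb4 0 b.
Proof.
rewrite /hilb4 !sum4E !weightHE /hsym_sum !exprS !expr0; field; monomials_differ.
Qed.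

Let expr_double_add x a b :
  x ^+ (a.*2 + b).+4 = (x ^+ a) ^+ 2 * x ^+ b * x ^+ 4 :> F.
Proof. by rewrite -addn4 !exprD -muln2 exprM. Qed.

Lemma hilb4_SS a b : hilb4 a.+1 b.+1 =
  hsym_sum q t (a.*2 + b).+3 / (1 - q) / (1 - t) + q * t * hilb4 a b.
Proof.
rewrite /hilb4 !sum4E !weightHE /hsym_sum !expr_double_add !(exprAC _ 2).
by rewrite !(exprS _ a) !(exprS _ b); field; monomials_differ.
Qed.

Lemma catalan4_0 b : catalan4 0 b = hsym q t b.
Proof.
rewrite /catalan4 sum4E !weightFE /hsym !exprS !expr0; field; monomials_differ.
Qed.

Lemma catalan4_SS a b : catalan4 a.+1 b.+1 =
  hsym q t (a.*2 + b).+3 + q * t * catalan4 a b.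
Proof.
rewrite /catalan4 !sum4E !weightFE /hsym !expr_double_add !(exprAC _ 2).
by rewrite !(exprS _ a) !(exprS _ b); field; monomials_differ.
Qed.

End TableauSums.

(** * The standard tableaux with three boxes *)

Section Tableaux3.
Local Notation tableau := {ffun 'I_3 -> 'I_3 * 'I_3}.

Lemma forall_I3 (P : pred 'I_3) :
  [forall i, P i] = all (fun i => P (inord i)) (iota 0 3).
Proof.
apply/forallP/allP => [Pall i _ | Pall i]; first exact: Pall.
by rewrite -(inord_val i); apply: Pall; rewrite mem_iota /= ltn_ord.
Qed.

(** The conditions of [standard] on the list of the positions of the three
    boxes, in a form that computes. *)
Definition standard_cells (s : seq (nat * nat)) : bool :=
  let c := nth (0, 0)%N s in let I := iota 0 3 in
  [&& all (fun i => all (fun j => (c i == c j) ==> (i == j)) I) I,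
      all (fun i => all (fun r => all (fun k =>
        (r <= (c i).1)%N && (k <= (c i).2)%N ==>
          has (fun j => c j == (r, k)) I) I) I) I,
      all (fun i => all (fun j =>
        ((c i).1 == (c j).1) && ((c i).2 < (c j).2)%N ==> (i < j)%N) I) I
    & all (fun i => all (fun j =>
        ((c i).2 == (c j).2) && ((c i).1 < (c j).1)%N ==> (i < j)%N) I) I].

Definition cells (T : tableau) : seq (nat * nat) :=
  [seq ((T (inord i)).1 : nat, (T (inord i)).2 : nat) | i <- iota 0 3].

Definition tableau_of (s : seq (nat * nat)) : tableau :=
  [ffun i : 'I_3 => (inord (nth (0, 0)%N s i).1, inord (nth (0, 0)%N s i).2)].

Lemma cellsK : cancel cells tableau_of.
Proof.
move=> T; apply/ffunP => i; rewrite ffunE (nth_map 0%N) ?size_iota //.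
by rewrite nth_iota // !inord_val; case: (T i).
Qed.

Lemma standardE T : standard T = standard_cells (cells T).
Proof.
pose c := nth (0, 0)%N (cells T).
have memI (i : 'I_3) : (i : nat) \in iota 0 3 by rewrite mem_iota ltn_ord.
have cE i : (i < 3)%N ->
    c i = ((T (inord i)).1 : nat, (T (inord i)).2 : nat).
  by move=> lti3; rewrite /c (nth_map 0%N) ?size_iota // nth_iota.
rewrite /standard /standard_cells; cbv zeta; rewrite -/c; congr [&& _, _, _ & _].
- apply/injectiveP/allP => [Tinj i | Tinj i j Tij].
    rewrite mem_iota => /andP[_ lti3]; apply/allP => j.
    rewrite mem_iota => /andP[_ ltj3]; apply/implyP; rewrite !cE //.
    move=> /eqP[T1 T2]; have /Tinj/(congr1 val) : T (inord i) = T (inord j).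
      by rewrite [LHS]surjective_pairing [RHS]surjective_pairing;
        congr pair; apply: val_inj.
    by rewrite /= !inordK // => ->.
  have /allP/(_ _ (memI j)) := Tinj i (memI i).
  by rewrite !cE // !inord_val Tij eqxx => /eqP/val_inj.
- rewrite forall_I3; apply: eq_in_all => i; rewrite mem_iota => /andP[_ lti3].
  apply/forallP/allP => [Tall r | Tall [r k]].
    rewrite mem_iota => /andP[_ ltr3]; apply/allP => k.
    rewrite mem_iota => /andP[_ ltk3]; apply/implyP; rewrite cE // => le_rk.
    have /implyP := Tall (inord r, inord k); rewrite !inordK //.
    move=> /(_ le_rk)/codomP[j Tj]; apply/hasP; exists (j : nat).
      by rewrite mem_iota ltn_ord.
    by rewrite cE // inord_val -Tj /= !inordK.
  apply/implyP => le_rk; have /allP/(_ _ (memI k)) := Tall r (memI r).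
  rewrite cE // => /implyP/(_ le_rk)/hasP[j].
  rewrite mem_iota => /andP[_ ltj3]; rewrite cE // => /eqP[Tr Tk].
  apply/codomP; exists (inord j); rewrite [RHS]surjective_pairing.
  by congr pair; apply: val_inj.
- rewrite forall_I3; apply: eq_in_all => i; rewrite mem_iota => /andP[_ lti3].
  rewrite forall_I3; apply: eq_in_all => j; rewrite mem_iota => /andP[_ ltj3].
  by rewrite !cE // !inordK.
rewrite forall_I3; apply: eq_in_all => i; rewrite mem_iota => /andP[_ lti3].
rewrite forall_I3; apply: eq_in_all => j; rewrite mem_iota => /andP[_ ltj3].
by rewrite !cE // !inordK.
Qed.

Definition standard3 : seq (seq (nat * nat)) :=
  [:: [:: (0, 0); (0, 1); (0, 2)]; [:: (0, 0); (0, 1); (1, 0)];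
      [:: (0, 0); (1, 0); (0, 1)]; [:: (0, 0); (1, 0); (2, 0)]]%N.

(** By evaluating the conditions on all [3^6] lists of positions. *)
Lemma standard_cellsE T : standard_cells (cells T) = (cells T \in standard3).
Proof.
have grid : all (fun r0 => all (fun c0 => all (fun r1 => all (fun c1 =>
      all (fun r2 => all (fun c2 =>
        let s := [:: (r0, c0); (r1, c1); (r2, c2)] in
        standard_cells s == (s \in standard3))
      (iota 0 3)) (iota 0 3)) (iota 0 3)) (iota 0 3)) (iota 0 3)) (iota 0 3).
  by vm_compute.
have all_I3 (P : pred nat) : all P (iota 0 3) -> forall i : 'I_3, P i.
  by move=> /allP Pall i; apply: Pall; rewrite mem_iota ltn_ord.
move: grid => /all_I3/(_ (T (inord 0)).1)/all_I3/(_ (T (inord 0)).2).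
move=> /all_I3/(_ (T (inord 1)).1)/all_I3/(_ (T (inord 1)).2).
by move=> /all_I3/(_ (T (inord 2)).1)/all_I3/(_ (T (inord 2)).2)/eqP.
Qed.

Lemma sum_standard3 (V : nmodType) (f : tableau -> V) :
  \sum_(T | standard T) f T = \sum_(s <- standard3) f (tableau_of s).
Proof.
have tableau_ofK : {in standard3, cancel tableau_of cells}.
  by move=> s; rewrite !inE => /or4P[] /eqP->;
    rewrite /cells /= !ffunE !inordK.
rewrite -(big_map tableau_of xpredT f) -[LHS]big_filter; apply: perm_big; apply: uniq_perm.
- by rewrite filter_uniq // /index_enum -enumT enum_uniq.
- by rewrite map_inj_in_uniq //; apply: can_in_inj tableau_ofK.
move=> T; rewrite mem_filter mem_index_enum andbT standardE standard_cellsE.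
apply/idP/mapP => [sT | [s s3 ->]]; last by rewrite tableau_ofK.
by exists (cells T); rewrite ?cellsK.
Qed.

End Tableaux3.

Section RatfunSums.

Lemma content_tableau_of s (i : 'I_3) :
    ((nth (0, 0)%N s i).1 < 3)%N -> ((nth (0, 0)%N s i).2 < 3)%N ->
  content (tableau_of s) i =
    qv ^+ (nth (0, 0)%N s i).2 * tv ^+ (nth (0, 0)%N s i).1.
Proof. by move=> lt1 lt2; rewrite /content ffunE !inordK. Qed.

Lemma big_ord_pos3 (V : Type) (idx : V) (op : Monoid.law idx) (f : 'I_3 -> V) :
  \big[op/idx]_(i < 3 | (0 < i)%N) f i = op (f 1) (f 2).
Proof.
rewrite big_mkcond !big_ord_recl big_ord0 /= Monoid.mul1m Monoid.mulm1.
by congr (op (f _) (f _)); apply: val_inj.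
Qed.

Lemma big_ord_lt3 (V : Type) (idx : V) (op : Monoid.com_law idx)
    (f : 'I_3 -> 'I_3 -> V) :
  \big[op/idx]_(i < 3) \big[op/idx]_(j < 3 | (i < j)%N) f i j =
  op (op (f 0 1) (f 0 2)) (f 1 2).
Proof.
rewrite !big_ord_recl !big_ord0 !(big_mkcond (fun j : 'I_3 => _ < j)%N).
rewrite !big_ord_recl !big_ord0 /= !Monoid.mulm1 !Monoid.mul1m.
by congr (op (op (f _ _) (f _ _)) (f _ _)); apply: val_inj.
Qed.

Lemma big_ord3 (V : Type) (idx : V) (op : Monoid.law idx) (f : 'I_3 -> V) :
  \big[op/idx]_(i < 3) f i = op (op (f 0) (f 1)) (f 2).
Proof.
rewrite !big_ord_recl big_ord0 Monoid.mulm1 Monoid.mulmA.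
by congr (op (op (f _) (f _)) (f _)); apply: val_inj.
Qed.

Lemma prod_contents3 d1 d2 d3 (z : 'I_3 -> {fraction {poly {poly rat}}}) :
    z 0 = 1 ->
  \prod_(i < 3) z i ^+ tnth [tuple d1; d2; d3] (rev_ord i) =
  1 ^+ 0 * z 1 ^+ d2 * z 2 ^+ d1.
Proof.
move=> z0; rewrite big_ord3 /= z0 !expr1n.
by congr (_ * _ ^+ _ * _ ^+ _); rewrite (tnth_nth 0%N).
Qed.

Lemma sum_standard3_weights (w : {fraction {poly {poly rat}}} -> _)
    (f : {ffun 'I_3 -> 'I_3 * 'I_3} -> {fraction {poly {poly rat}}}) :
    (forall T, content T 0 = 1 ->
      f T = w (content T 0) (content T 1) (content T 2)) ->
  \sum_(T | standard T) f T = sum4 qv tv w.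
Proof.
move=> fE; rewrite sum_standard3 !big_cons big_nil addr0 /sum4 !addrA.
have content0 s : nth (0, 0)%N s 0 = (0, 0)%N -> content (tableau_of s) 0 = 1.
  by move=> s0; rewrite content_tableau_of /= s0 // !expr0 mulr1.
rewrite !fE ?content0 // !content_tableau_of //=.
by rewrite !expr0 !expr1 !mulr1 !mul1r.
Qed.

(** Stated separately so that the two presentations of the field of fractions
    are compared only once. *)
Lemma factorE x : factor x = omit1 x.
Proof. reflexivity. Qed.

Lemma omegaE x : omega x = kernel_omega qv tv x.
Proof. by rewrite /omega !factorE. Qed.

Lemma Hfun3E d1 d2 d3 : Hfun [tuple d1; d2; d3] = hilb4 qv tv d1 d2.
Proof.
apply: sum_standard3_weights => T T0; cbv zeta.
rewrite (big_ord_lt3 _ (fun i j => omega (content T i / content T j))).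
rewrite (big_ord_pos3 _ (fun i => (factor (content T i)^-1)^-1)).
rewrite (prod_contents3 _ _ _ T0) T0.
rewrite !omegaE !factorE.
by rewrite /weightH; congr (_ * _).
Qed.

Lemma Ffun3E d1 d2 d3 : Ffun [tuple d1; d2; d3] = catalan4 qv tv d1 d2.
Proof.
apply: sum_standard3_weights => T T0; cbv zeta.
rewrite (big_ord_lt3 _ (fun i j => omega (content T i / content T j))).
rewrite (big_ord_pos3 _ (fun i => (factor (content T i)^-1 *
  factor (qv * tv * content T (ord_pred i) / content T i))^-1)).
rewrite (prod_contents3 _ _ _ T0) T0.
have -> : ord_pred 1 = 0 :> 'I_3 by apply: val_inj.
have -> : ord_pred 2 = 1 :> 'I_3 by apply: val_inj.
rewrite T0 !omegaE !factorE.
by rewrite /weightF; congr (_ * _).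
Qed.

(** The rational function and the dimension count satisfy the same recursions.
    For [a = 0] only [b] decreases, until [(0, 0)], where the recursion is
    stationary and is solved by dividing by [1 - q t]. *)
Lemma is_expansion_dim_ideal a b : (a <= b)%N ->
  is_expansion (hilb4 qv tv a b) (dim_ideal a b).
Proof.
have sumE e := is_expansion_div1t (is_expansion_div1q (is_expansion_hsym_sum e)).
have step a' b' f g : is_expansion f (dim_ideal a'.-1 b'.-1) ->
    g = hsym_sum qv tv (a'.*2 + b') / (1 - qv) / (1 - tv) + qv * tv * f ->
  is_expansion g (dim_ideal a' b').
  move=> fE ->; rewrite -[qv * tv * f]mulrA.
  apply: eq_is_expansion (is_expansionD (sumE _)
    (is_expansion_qvM (is_expansion_tvM fE))) => A B.
  rewrite exchange_big; case: A => [|A] //.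
move=> leab; rewrite -(subnKC leab); move: (b - a)%N => k.
elim: a {leab} => [|a IHa]; last first.
  rewrite addSn; apply: (step a.+1 (a + k).+1 _ _ IHa).
  by rewrite (hilb4_SS qv_exp_tv_exp_inj) doubleS !addSn addnS.
elim: k => [|k IHk]; last first.
  apply: (step 0%N k.+1 _ _ IHk).
  by rewrite (hilb4_0S qv_exp_tv_exp_inj).
rewrite (hilb4_00 qv_exp_tv_exp_inj).
apply: is_expansion_div1qt (sumE _) _ => A B.
by rewrite exchange_big; case: A.
Qed.

(** The dimension count takes the value 1 from the first matching layer
    whereas the series adds up the layers; [dim_generators_above] shows that
    no two of them overlap. *)
Lemma is_expansion_dim_generators a b : (a <= b)%N ->
  is_expansion (catalan4 qv tv a b) (dim_generators a b).
Proof.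
elim: a b => [|a IHa] b leab.
  rewrite (catalan4_0 qv_exp_tv_exp_inj).
  apply: eq_is_expansion (is_expansion_hsym b) => A B /=.
  by case: eqP.
case: b leab => // b leab; rewrite (catalan4_SS qv_exp_tv_exp_inj) -mulrA.
apply: eq_is_expansion (is_expansionD (is_expansion_hsym _)
  (is_expansion_qvM (is_expansion_tvM (IHa b leab)))) => A B.
rewrite /= doubleS addSn addSn addnS; case: eqP => [AB|_]; last first.
  by case: A => // A; case: B.
by case: A AB => // A; case: B => // B AB; rewrite dim_generators_above //; lia.
Qed.

End RatfunSums.

(** * Hilbert series of the intersection ideal *)

Lemma Jprime3E (K : fieldType) d1 d2 d3 : (d1 <= d2)%N -> (d2 <= d3)%N ->
  @Jprime K 3 [tuple d1; d2; d3] = diag_inter d1 d2.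
Proof.
move=> h12 h23; have h13 := leq_trans h12 h23.
apply/seteqP; split=> p /=.
  move=> pJ; split; [have := pJ o1 o2 isT | have := pJ o0 o1 isT
    | have := pJ o0 o2 isT]; rewrite !(tnth_nth 0%N) /=.
  - by rewrite (minn_idPl h23).
  - by rewrite (minn_idPl h12).
  by rewrite (minn_idPl h13).
move=> [p12 p01 p02] i j; case: (I3P i) => ->; case: (I3P j) => -> // _;
  rewrite !(tnth_nth 0%N) /=.
- by rewrite (minn_idPl h12).
- by rewrite (minn_idPl h13).
by rewrite (minn_idPl h23).
Qed.

Local Close Scope ring_scope.
Unset Implicit Arguments.

Theorem theorem1p11 (R : realType) (d1 d2 d3 : nat)
    (h12 : (d1 <= d2)%N) (h23 : (d2 <= d3)%N) :
  let d := [tuple d1; d2; d3] in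
  let J : set {mpoly R[i][3 + 3]} := Jprime d in
  (exists h : nat -> nat -> nat,
     hilbert_series J h /\ is_expansion (Hfun d) h) /\
  (exists h : nat -> nat -> nat,
     hilbert_series_mod J (ideal_mul (@irrelevant_ideal R[i] 3) J) h /\
     is_expansion (Ffun d) h).
Proof.
move=> d J; have two_neq0 : (2%:R != 0 :> R[i])%R by rewrite pnatr_eq0.
have -> : J = diag_inter d1 d2 by apply: Jprime3E.
split.
  exists (dim_ideal d1 d2); split.
    by move=> A B; apply: has_dim_diag_inter.
  by rewrite Hfun3E; apply: is_expansion_dim_ideal.
exists (dim_generators d1 d2); split.
  by move=> A B; apply: has_dim_generators.
by rewrite Ffun3E; apply: is_expansion_dim_generators.
Qed.
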